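(* Let $K$ be the Cantor space, let $\Omega$ be a finite-dimensional connected finite CW-complex, $X=K\times\Omega$, and let $\alpha:X\to X$ be a minimal homeomorphism. If $\mathrm{RR}(A_{\{x\}})=0$ for some $x\in K$, then $\alpha$ is rigid.
   Context: $A_\alpha=C^*(X,\alpha)$ is the crossed product, generated by $C(X)$ and the implementing unitary $u_\alpha$, $u_\alpha fu_\alpha^*=f\circ\alpha^{-1}$. For $x\in K$, $A_{\{x\}}=C^*\{C(X),\,u_\alpha C_0((K\setminus\{x\})\times\Omega)\}\subset A_\alpha$ is the orbit-breaking subalgebra. $\mathrm{RR}$ denotes real rank. $T(A)$ is the tracial state space of $A$, $\mathrm{Aff}(T(A))$ the space of real continuous affine functions on it, and $\rho_A:K_0(A)\to\mathrm{Aff}(T(A))$ is $\rho_A([p]-[q])(\tau)=(\tau\otimes\mathrm{Tr})(p)-(\tau\otimes\mathrm{Tr})(q)$ with $\mathrm{Tr}$ the unnormalized trace. $\alpha$ is rigid if $\rho_{A_\alpha}(K_0(A_\alpha))$ is uniformly dense in $\mathrm{Aff}(T(A_\alpha))$. *)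

(* Defs.v *)
From HB Require Import structures.
From mathcomp Require Import all_boot all_order all_algebra.
From mathcomp Require Import complex.
From mathcomp Require Import all_classical all_reals all_analysis.

Set Implicit Arguments.
Unset Strict Implicit.
Unset Printing Implicit Defensive.

Import Order.TTheory GRing.Theory Num.Theory.
Import numFieldNormedType.Exports.

Local Open Scope classical_set_scope.
Local Open Scope ring_scope.
Local Open Scope complex_scope.
Local Open Scope quotient_scope.

(* [algType] rules out the zero algebra, which is not the crossed product of a
   nonempty space. *)

HB.mixin Record isStarAlgebra (R : realType) A & GRing.Algebra R[i] A := {
  star : A -> A;
  starK : forall a : A, star (star a) = a;
  starD : forall a b : A, star (a + b) = star a + star b;
  starZ : forall (c : R[i]) (a : A), star (c *: a) = c^* *: star a;
  starM : forall a b : A, star (a * b) = star b * star a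
}.

#[short(type="starAlgType")]
HB.structure Definition StarAlgebra (R : realType) :=
  {A of GRing.Algebra R[i] A & isStarAlgebra R A}.

(* The norm is a field of the mixin because the hierarchies of the libraries have
   no join of rings and normed modules other than [numDomainType].  It takes
   values in R. *)
HB.mixin Record isCStarAlgebra (R : realType) A & StarAlgebra R A := {
  cnorm : A -> R;
  cnorm_eq0 : forall a : A, cnorm a = 0 -> a = 0;
  cnormZ : forall (c : R[i]) (a : A), (cnorm (c *: a))%:C = `|c| * (cnorm a)%:C;
  cnormD : forall a b : A, cnorm (a + b) <= cnorm a + cnorm b;
  cnormM : forall a b : A, cnorm (a * b) <= cnorm a * cnorm b;
  cnorm_star : forall a : A, cnorm (star a * a) = cnorm a ^+ 2;
  cnorm_complete : forall a_ : nat -> A,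
    (forall e : R, 0 < e -> exists N : nat, forall m n : nat,
       (N <= m)%N -> (N <= n)%N -> cnorm (a_ m - a_ n) < e) ->
    exists a : A, forall e : R, 0 < e -> exists N : nat, forall n : nat,
      (N <= n)%N -> cnorm (a_ n - a) < e
}.

#[short(type="cstarAlgType")]
HB.structure Definition CStarAlgebra (R : realType) :=
  {A of StarAlgebra R A & isCStarAlgebra R A}.

Definition star_hom (R : realType) (A B : starAlgType R) (phi : A -> B) :=
  [/\ linear phi, monoid_morphism phi & forall a, phi (star a) = star (phi a)].

Definition selfadjoint (R : realType) (A : starAlgType R) (a : A) :=
  star a = a.

Definition unitary (R : realType) (A : starAlgType R) (u : A) :=
  star u * u = 1 /\ u * star u = 1.

Definition cnorm_closed (R : realType) (A : cstarAlgType R) (S : set A) :=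
  forall a : A,
    (forall e : R, 0 < e -> exists2 b, S b & cnorm (a - b) < e) -> S a.

(* Unital C*-subalgebras, as sets. *)
Definition cstar_subalgebra (R : realType) (A : cstarAlgType R) (S : set A) :=
  [/\ S 1,
      forall (c : R[i]) (a b : A), S a -> S b -> S (c *: a + b),
      forall a b : A, S a -> S b -> S (a * b),
      forall a : A, S a -> S (star a) &
      cnorm_closed S].

Definition cstar_generated (R : realType) (A : cstarAlgType R) (G : set A) :
    set A :=
  \bigcap_(S in [set S | cstar_subalgebra S /\ G `<=` S]) S.

(* The real rank of Brown and Pedersen, for a unital C*-subalgebra S of A: the
   inverse of the sum of squares is required to lie in S. *)
Definition real_rank_le (R : realType) (A : cstarAlgType R) (S : set A)
    (n : nat) :=
  forall (a : 'I_n.+1 -> A) (e : R),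
    (forall k, S (a k) /\ selfadjoint (a k)) -> 0 < e ->
    exists b : 'I_n.+1 -> A,
      [/\ forall k, S (b k) /\ selfadjoint (b k),
          exists2 c, S c & (\sum_k b k ^+ 2) * c = 1 /\
                           c * (\sum_k b k ^+ 2) = 1 &
          cnorm (\sum_k (a k - b k) ^+ 2) < e].

Definition real_rank (R : realType) (A : cstarAlgType R) (S : set A) : \bar R :=
  ereal_inf [set n%:R%:E | n in [set n | real_rank_le S n]].

Definition Cfun (R : realType) (X : topologicalType) : Type :=
  continuousType X R[i]^o.

Section Cfun.
Variables (R : realType) (X : topologicalType).
Local Notation CX := (Cfun R X).
Local Notation C := R[i]^o.

Definition Cval (f : CX) : X -> C := f.

HB.instance Definition _ := Choice.copy CX (continuousType X C).

Lemma Cfun_eqP (f g : CX) : (forall x, Cval f x = Cval g x) -> f = g.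
Proof. by move=> fg; apply/continuousEP. Qed.

Lemma Cval_cts (f : CX) : continuous (Cval f).
Proof. exact: cts_fun. Qed.

Definition mkC (f : X -> C) (cf : continuous f) : CX := mkcts cf.

Lemma Cfun_add_cts (f g : CX) : continuous (fun x => Cval f x + Cval g x).
Proof. by move=> x; apply: cvgD; exact: Cval_cts. Qed.
Lemma Cfun_opp_cts (f : CX) : continuous (fun x => - Cval f x).
Proof. by move=> x; apply: cvgN; exact: Cval_cts. Qed.
Lemma Cfun_mul_cts (f g : CX) :
  continuous (fun x => Cval f x * Cval g x : C).
Proof. by move=> x; apply: cvgM; exact: Cval_cts. Qed.
Lemma Cfun_scale_cts (c : R[i]) (f : CX) :
  continuous (fun x => c * Cval f x : C).
Proof. by move=> x; apply: cvgM; [exact: cvg_cst|exact: Cval_cts]. Qed.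
Lemma Cfun_cst_cts (c : R[i]) : continuous (fun _ : X => c : C).
Proof. by move=> x; exact: cvg_cst. Qed.
Lemma Cfun_conj_cts (f : CX) : continuous (fun x => (Cval f x)^* : C).
Proof.
move=> x; apply: (@continuous_comp _ _ _ (Cval f) (fun z : C => z^* : C)).
  exact: Cval_cts.
move=> P /nbhs_ballP[e e0 eP]; apply/nbhs_ballP; exists e => //= z.
rewrite -ball_normE /= => ze; apply: eP; rewrite -ball_normE /=.
by rewrite -rmorphB /=; move: ze; rewrite !normc_def /=; case: (_ - z) => u v /=;
  rewrite sqrrN.
Qed.

Definition Cconj (f : CX) : CX := mkC (@Cfun_conj_cts f).

Let addC f g := mkC (@Cfun_add_cts f g).
Let oppC f := mkC (@Cfun_opp_cts f).
Let mulC f g := mkC (@Cfun_mul_cts f g).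
Let scaleC c f := mkC (@Cfun_scale_cts c f).
Let zeroC := mkC (@Cfun_cst_cts 0).
Let oneC := mkC (@Cfun_cst_cts 1).

Let addCA : associative addC.
Proof. by move=> f g h; apply: Cfun_eqP => x; apply: addrA. Qed.
Let addCC : commutative addC.
Proof. by move=> f g; apply: Cfun_eqP => x; apply: addrC. Qed.
Let add0C : left_id zeroC addC.
Proof. by move=> f; apply: Cfun_eqP => x; apply: add0r. Qed.
Let addNC : left_inverse zeroC oppC addC.
Proof. by move=> f; apply: Cfun_eqP => x; apply: addNr. Qed.
HB.instance Definition _ := GRing.isZmodule.Build CX addCA addCC add0C addNC.

Let mulCA : associative mulC.
Proof. by move=> f g h; apply: Cfun_eqP => x; apply: mulrA. Qed.
Let mul1C : left_id oneC mulC.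
Proof. by move=> f; apply: Cfun_eqP => x; apply: mul1r. Qed.
Let mulC1 : right_id oneC mulC.
Proof. by move=> f; apply: Cfun_eqP => x; apply: mulr1. Qed.
Let mulCDl : left_distributive mulC +%R.
Proof. by move=> f g h; apply: Cfun_eqP => x; apply: mulrDl. Qed.
Let mulCDr : right_distributive mulC +%R.
Proof. by move=> f g h; apply: Cfun_eqP => x; apply: mulrDr. Qed.
HB.instance Definition _ :=
  GRing.Zmodule_isPzRing.Build CX mulCA mul1C mulC1 mulCDl mulCDr.

Let scaleCA (a b : R[i]) (f : CX) : scaleC a (scaleC b f) = scaleC (a * b) f.
Proof. by apply: Cfun_eqP => x; apply: mulrA. Qed.
Let scale1C : left_id 1 scaleC.
Proof. by move=> f; apply: Cfun_eqP => x; apply: mul1r. Qed.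
Let scaleCDr : right_distributive scaleC +%R.
Proof. by move=> a f g; apply: Cfun_eqP => x; apply: mulrDr. Qed.
Let scaleCDl (f : CX) : {morph scaleC^~ f : a b / a + b}.
Proof. by move=> a b; apply: Cfun_eqP => x; apply: mulrDl. Qed.
HB.instance Definition _ :=
  GRing.Zmodule_isLmodule.Build R[i] CX scaleCA scale1C scaleCDr scaleCDl.

End Cfun.

Definition Cfun_star_hom (R : realType) (X : topologicalType)
    (A : starAlgType R) (phi : Cfun R X -> A) :=
  [/\ linear phi, monoid_morphism phi &
      forall f, phi (Cconj f) = star (phi f)].

Record homeomorphism (X : topologicalType) := Homeomorphism {
  homeo_fun :> X -> X;
  homeo_inv : X -> X;
  homeo_funK : cancel homeo_fun homeo_inv;
  homeo_invK : cancel homeo_inv homeo_fun;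
  homeo_fun_cts : continuous homeo_fun;
  homeo_inv_cts : continuous homeo_inv
}.

Definition minimal (X : topologicalType) (alpha : homeomorphism X) :=
  forall F : set X, closed F -> alpha @` F = F -> F = set0 \/ F = setT.

Lemma Cfun_comp_cts (R : realType) (X : topologicalType) (f : Cfun R X)
    (g : X -> X) : continuous g -> continuous (Cval f \o g).
Proof. by move=> cg x; apply: continuous_comp; [exact: cg|exact: Cval_cts]. Qed.

Definition Cfun_inv (R : realType) (X : topologicalType)
    (alpha : homeomorphism X) (f : Cfun R X) : Cfun R X :=
  mkC (@Cfun_comp_cts _ _ f _ (@homeo_inv_cts _ alpha)).

Definition covariant (R : realType) (X : topologicalType)
    (alpha : homeomorphism X) (A : cstarAlgType R) (iota : Cfun R X -> A)
    (u : A) :=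
  [/\ Cfun_star_hom iota, unitary u &
      forall f, u * iota f * star u = iota (Cfun_inv alpha f)].

(* (A, iota, u) is C*(X, alpha): the universal C*-algebra generated by C(X) and
   a unitary implementing alpha.  The morphism pi is automatically
   unique, as A is generated by C(X) and u. *)
Definition crossed_product (R : realType) (X : topologicalType)
    (alpha : homeomorphism X) (A : cstarAlgType R) (iota : Cfun R X -> A)
    (u : A) :=
  [/\ covariant alpha iota u,
      cstar_generated (range iota `|` [set u]) = setT &
      forall (B : cstarAlgType R) (phi : Cfun R X -> B) (v : B),
        covariant alpha phi v ->
        exists pi : A -> B,
          [/\ star_hom pi, forall f, pi (iota f) = phi f & pi u = v]].

(* C_0((K \ {x}) * Omega) is identified with the functions of C(K * Omega) that
   vanish on {x} * Omega; K is compact in the intended use. *)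
Definition orbit_breaking (R : realType) (K Omega : topologicalType)
    (A : cstarAlgType R) (iota : Cfun R (K * Omega)%type -> A) (u : A) (x : K) :
    set A :=
  cstar_generated
    (range iota `|`
     [set u * iota f | f in [set f | forall w, Cval f (x, w) = 0]]).

Definition euclidean_ball (R : realType) (n : nat) : set 'rV[R]_n :=
  [set x | \sum_k x ord0 k ^+ 2 <= 1].
Definition euclidean_open_ball (R : realType) (n : nat) : set 'rV[R]_n :=
  [set x | \sum_k x ord0 k ^+ 2 < 1].
Definition euclidean_sphere (R : realType) (n : nat) : set 'rV[R]_n :=
  [set x | \sum_k x ord0 k ^+ 2 = 1].

(* Phi i is the characteristic map of the i-th cell, of dimension d i.  Having
   finitely many cells makes the complex finite-dimensional, and the
   closure-finiteness and weak-topology axioms automatic. *)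
Definition finite_CW_complex (R : realType) (Omega : topologicalType) :=
  hausdorff_space Omega /\
  exists (I : finType) (d : I -> nat) (Phi : forall i, 'rV[R]_(d i) -> Omega),
    [/\ forall i, {within @euclidean_ball R (d i), continuous (Phi i)},
        forall i, set_inj (@euclidean_open_ball R (d i)) (Phi i),
        forall w, exists i, (Phi i @` @euclidean_open_ball R (d i)) w,
        forall i j w, (Phi i @` @euclidean_open_ball R (d i)) w ->
                      (Phi j @` @euclidean_open_ball R (d j)) w -> i = j &
        forall i, Phi i @` @euclidean_sphere R (d i) `<=`
          \bigcup_(j in [set j | (d j < d i)%N])
             (Phi j @` @euclidean_open_ball R (d j))].

(* The weak-* topology on T(A) is the topology of pointwise convergence. *)
Definition tracial_states (R : realType) (A : cstarAlgType R) :
    set {ptws A -> R[i]^o} :=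
  [set t | [/\ linear (t : A -> R[i]^o),
               forall a : A, (0 : R[i]) <= t (star a * a),
               t 1 = 1 &
               forall a b : A, t (a * b) = t (b * a)]].

Definition Aff_T (R : realType) (A : cstarAlgType R) :
    set ({ptws A -> R[i]^o} -> R) :=
  [set h | {within @tracial_states R A, continuous h} /\
     forall (s t : {ptws A -> R[i]^o}) (l : R),
       tracial_states s -> tracial_states t -> 0 <= l <= 1 ->
       h (fun a => l%:C * s a + (1 - l)%:C * t a) = l * h s + (1 - l) * h t].

Section Adjoint.
Variables (R : realType) (A : starAlgType R).

Definition adjmx m n (M : 'M[A]_(m, n)) : 'M[A]_(n, m) :=
  \matrix_(i, j) star (M j i).

Lemma star0 : star (0 : A) = 0.
Proof. by apply: (addrI (star 0)); rewrite -starD !addr0. Qed.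

Lemma star_sum (I : finType) (F : I -> A) :
  star (\sum_k F k) = \sum_k star (F k).
Proof. by apply: (big_morph _ (@starD _ _) star0). Qed.

Lemma adjmxK m n (M : 'M[A]_(m, n)) : adjmx (adjmx M) = M.
Proof. by apply/matrixP => i j; rewrite !mxE starK. Qed.

Lemma adjmx0 m n : adjmx (0 : 'M[A]_(m, n)) = 0.
Proof. by apply/matrixP => i j; rewrite !mxE star0. Qed.

Lemma adjmxM m n p (M : 'M[A]_(m, n)) (N : 'M[A]_(n, p)) :
  adjmx (M *m N) = adjmx N *m adjmx M.
Proof.
apply/matrixP => i j; rewrite !mxE star_sum; apply: eq_bigr => k _.
by rewrite starM !mxE.
Qed.

Lemma adj_row_mx m n1 n2 (M : 'M[A]_(m, n1)) (N : 'M[A]_(m, n2)) :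
  adjmx (row_mx M N) = col_mx (adjmx M) (adjmx N).
Proof. by apply/matrixP => i j; rewrite !mxE; case: (fintype.split _) => k; rewrite mxE. Qed.

Lemma adj_col_mx m1 m2 n (M : 'M[A]_(m1, n)) (N : 'M[A]_(m2, n)) :
  adjmx (col_mx M N) = row_mx (adjmx M) (adjmx N).
Proof. by apply/matrixP => i j; rewrite !mxE; case: (fintype.split _) => k; rewrite mxE. Qed.

Lemma adj_block_mx m1 m2 n1 n2 (M : 'M[A]_(m1, n1)) (N : 'M[A]_(m1, n2))
    (P : 'M[A]_(m2, n1)) (Q : 'M[A]_(m2, n2)) :
  adjmx (block_mx M N P Q) =
  block_mx (adjmx M) (adjmx P) (adjmx N) (adjmx Q).
Proof. by rewrite /block_mx adj_col_mx !adj_row_mx -block_mxEh. Qed.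

Record projection := Projection {
  proj_dim : nat;
  proj_mx :> 'M[A]_proj_dim;
  proj_adj : adjmx proj_mx = proj_mx;
  proj_idem : proj_mx *m proj_mx = proj_mx
}.

HB.instance Definition _ := gen_eqMixin projection.
HB.instance Definition _ := gen_choiceMixin projection.

Definition mvn (p q : projection) : bool :=
  `[< exists v : 'M[A]_(proj_dim p, proj_dim q),
        v *m adjmx v = p /\ adjmx v *m v = q >].

Lemma mvn_refl : reflexive mvn.
Proof. by move=> p; apply/asboolP; exists p; rewrite !proj_adj proj_idem. Qed.

Lemma mvn_sym : symmetric mvn.
Proof.
by move=> p q; apply/idP/idP => /asboolP[v [vp vq]]; apply/asboolP;
  exists (adjmx v); rewrite adjmxK.
Qed.

Lemma mvn_trans : transitive mvn.
Proof.
move=> q p r /asboolP[v [vp vq]] /asboolP[w [wq wr]]; apply/asboolP.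
exists (v *m w); rewrite adjmxM; split.
  by rewrite -mulmxA (mulmxA w) wq -vq -(mulmxA (adjmx v)) mulmxA vp proj_idem.
by rewrite -mulmxA (mulmxA (adjmx v)) vq -wq -(mulmxA w) mulmxA wr proj_idem.
Qed.

Canonical mvn_equiv := EquivRel mvn mvn_refl mvn_sym mvn_trans.

Definition oplus_mx (p q : projection) : 'M[A]_(proj_dim p + proj_dim q) :=
  block_mx (proj_mx p) 0 0 (proj_mx q).

Lemma oplus_adj (p q : projection) : adjmx (oplus_mx p q) = oplus_mx p q.
Proof. by rewrite adj_block_mx !adjmx0 !proj_adj. Qed.

Lemma oplus_idem (p q : projection) :
  oplus_mx p q *m oplus_mx p q = oplus_mx p q.
Proof. by rewrite mulmx_block !mul0mx !mulmx0 !proj_idem addr0 !add0r. Qed.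

Definition oplus (p q : projection) :=
  Projection (oplus_adj p q) (oplus_idem p q).

Lemma proj0_adj : adjmx (0 : 'M[A]_0) = 0. Proof. exact: adjmx0. Qed.
Lemma proj0_idem : (0 : 'M[A]_0) *m (0 : 'M[A]_0) = 0. Proof. exact: mulmx0. Qed.
Definition proj0 := Projection proj0_adj proj0_idem.

Lemma mvn_oplus p p' q q' :
  mvn p p' -> mvn q q' -> mvn (oplus p q) (oplus p' q').
Proof.
move=> /asboolP[v [vp vp']] /asboolP[w [wq wq']]; apply/asboolP.
exists (block_mx v 0 0 w); rewrite adj_block_mx !adjmx0 !mulmx_block.
by rewrite !mul0mx !mulmx0 !addr0 !add0r vp vp' wq wq'.
Qed.

Lemma mvn_oplus0 p : mvn (oplus proj0 p) p.
Proof.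
apply/asboolP; exists (col_mx 0 (proj_mx p)); rewrite adj_col_mx adjmx0 proj_adj.
rewrite mul_col_row mul_row_col !mul0mx !mulmx0 proj_idem add0r.
by split.
Qed.

Lemma mvn_oplusC p q : mvn (oplus p q) (oplus q p).
Proof.
apply/asboolP; exists (block_mx 0 (proj_mx p) (proj_mx q) 0).
rewrite adj_block_mx !adjmx0 !proj_adj !mulmx_block.
by rewrite !mul0mx !mulmx0 !proj_idem !addr0 !add0r.
Qed.

Lemma mvn_oplusA p q r : mvn (oplus p (oplus q r)) (oplus (oplus p q) r).
Proof.
rewrite mvn_sym; apply/asboolP.
exists (block_mx (col_mx (proj_mx p) 0) (block_mx 0 0 (proj_mx q) 0)
                 0 (row_mx 0 (proj_mx r))).
rewrite adj_block_mx adj_col_mx adj_row_mx adj_block_mx !adjmx0 !proj_adj.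
rewrite !mulmx_block !mul_col_row !mul_row_col ?mulmx_block.
rewrite !mul0mx !mulmx0 ?mul_row_block ?mul_block_col ?mul_col_mx.
rewrite ?mul_mx_row ?mul_row_col ?mul_col_row !mul0mx !mulmx0 !proj_idem.
rewrite ?(addr0, add0r) ?row_mx0 ?col_mx0 ?block_mx0 ?add_block_mx.
by rewrite ?(addr0, add0r) ?row_mx0 ?col_mx0.
Qed.

(* The Murray-von Neumann semigroup of projections in the matrix algebras. *)
Definition mvn_semigroup := {eq_quot mvn_equiv}.
HB.instance Definition _ := Choice.on mvn_semigroup.

Definition mvn_class (p : projection) : mvn_semigroup := \pi p.

Lemma mvn_classP p q : reflect (mvn_class p = mvn_class q) (mvn p q).
Proof. by apply: (iffP idP) => [pq|/eqmodP//]; apply/eqmodP. Qed.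

Lemma mvn_classK (x : mvn_semigroup) : mvn_class (repr x) = x.
Proof. exact: reprK. Qed.

Let add (x y : mvn_semigroup) := mvn_class (oplus (repr x) (repr y)).

Let addE p q : add (mvn_class p) (mvn_class q) = mvn_class (oplus p q).
Proof. by apply/mvn_classP/mvn_oplus; apply/mvn_classP; rewrite mvn_classK. Qed.

Let addA : associative add.
Proof.
move=> x y z; rewrite -(mvn_classK x) -(mvn_classK y) -(mvn_classK z) !addE.
exact/mvn_classP/mvn_oplusA.
Qed.

Let addC : commutative add.
Proof.
move=> x y; rewrite -(mvn_classK x) -(mvn_classK y) !addE.
exact/mvn_classP/mvn_oplusC.
Qed.

Let add0 : left_id (mvn_class proj0) add.
Proof.
by move=> x; rewrite -(mvn_classK x) addE; exact/mvn_classP/mvn_oplus0.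
Qed.

HB.instance Definition _ := GRing.isNmodule.Build mvn_semigroup addA addC add0.

Lemma mvn_classD p q : mvn_class (oplus p q) = mvn_class p + mvn_class q.
Proof. by rewrite -addE. Qed.

End Adjoint.

Section Grothendieck.
Variable M : nmodType.

Definition groth_rel (x y : M * M) : bool :=
  `[< exists k, x.1 + y.2 + k = y.1 + x.2 + k >].

Lemma groth_refl : reflexive groth_rel.
Proof. by move=> x; apply/asboolP; exists 0. Qed.

Lemma groth_sym : symmetric groth_rel.
Proof.
by move=> x y; apply/idP/idP => /asboolP[k xy]; apply/asboolP; exists k.
Qed.

Lemma groth_trans : transitive groth_rel.
Proof.
move=> y x z /asboolP[k xy] /asboolP[l yz]; apply/asboolP.
exists (y.1 + y.2 + k + l).
transitivity ((x.1 + y.2 + k) + (y.1 + z.2 + l)).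
  by rewrite !addrA [LHS](ACl (1*4*5*3*2*6)%AC).
rewrite xy yz.
by rewrite !addrA [LHS](ACl (4*2*1*5*3*6)%AC).
Qed.

Canonical groth_equiv := EquivRel groth_rel groth_refl groth_sym groth_trans.

Definition grothendieck := {eq_quot groth_equiv}.
HB.instance Definition _ := Choice.on grothendieck.

Definition groth_class (x : M * M) : grothendieck := \pi x.
Local Notation cls := groth_class.

Lemma groth_classP x y : reflect (cls x = cls y) (groth_rel x y).
Proof. by apply: (iffP idP) => [xy|/eqmodP//]; apply/eqmodP. Qed.

Lemma groth_classK (x : grothendieck) : cls (repr x) = x.
Proof. exact: reprK. Qed.

Let add (x y : grothendieck) :=
  cls ((repr x).1 + (repr y).1, (repr x).2 + (repr y).2).
Let opp (x : grothendieck) := cls ((repr x).2, (repr x).1).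

Let addE x y : add (cls x) (cls y) = cls (x.1 + y.1, x.2 + y.2).
Proof.
have /groth_classP/asboolP[k xk] := groth_classK (cls x).
have /groth_classP/asboolP[l yl] := groth_classK (cls y).
apply/groth_classP/asboolP; exists (k + l) => /=.
rewrite !addrA [LHS](ACl ((1*3*5)*(2*4*6))%AC) [RHS](ACl ((1*3*5)*(2*4*6))%AC).
by rewrite /= xk yl.
Qed.

Let oppE x : opp (cls x) = cls (x.2, x.1).
Proof.
have /groth_classP/asboolP[k xk] := groth_classK (cls x).
apply/groth_classP/asboolP; exists k => /=.
by rewrite (addrC _ x.1) -xk (addrC x.2).
Qed.

Let addA : associative add.
Proof.
move=> x y z; rewrite -(groth_classK x) -(groth_classK y) -(groth_classK z) !addE /=.
by rewrite !addrA.
Qed.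

Let addC : commutative add.
Proof.
move=> x y; rewrite -(groth_classK x) -(groth_classK y) !addE.
by congr (cls (_, _)); exact: addrC.
Qed.

Let add0 : left_id (cls (0, 0)) add.
Proof. by move=> x; rewrite -(groth_classK x) addE /= !add0r -surjective_pairing. Qed.

Let addN : left_inverse (cls (0, 0)) opp add.
Proof.
move=> x; rewrite -(groth_classK x) oppE addE /=; apply/groth_classP/asboolP; exists 0 => /=.
by rewrite !addr0 add0r addrC.
Qed.

HB.instance Definition _ :=
  GRing.isZmodule.Build grothendieck addA addC add0 addN.

Definition groth_in (a : M) : grothendieck := cls (a, 0).

Lemma grothE (a b : M) :
  cls (a, b) = groth_in a - groth_in b.
Proof.
by rewrite -[RHS]/(add (cls (a, 0)) (opp (cls (b, 0)))) oppE addE /= addr0 add0r.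
Qed.

End Grothendieck.

Section K0.
Variables (R : realType) (A : cstarAlgType R).

Definition K0 : zmodType := grothendieck (mvn_semigroup A).

Definition K0_class (p : projection A) : K0 := groth_in (mvn_class p).

(* (tau (x) Tr)(p), as a real number. *)
Definition trace_proj (t : A -> R[i]^o) (p : projection A) : R :=
  complex.Re (\sum_k t (proj_mx p k k)).

(* Computed on representatives; [rhoE] shows that the choice is irrelevant on
   tracial states. *)
Definition rho (g : K0) (t : {ptws A -> R[i]^o}) : R :=
  let x := repr (g : grothendieck (mvn_semigroup A)) in
  trace_proj t (repr x.1) - trace_proj t (repr x.2).

Lemma trace_proj_mvn (t : {ptws A -> R[i]^o}) p q :
  tracial_states t -> mvn p q -> trace_proj t p = trace_proj t q.
Proof.
move=> [tl _ _ tC] /asboolP[v [vp vq]]; rewrite /trace_proj -vp -vq.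
have tD : {morph t : a b / a + b >-> a + b}.
  by move=> a b; have := tl 1 a b; rewrite !scale1r.
have t0 : t 0 = 0 by apply: (addrI (t 0)); rewrite -tD !addr0.
have tE := big_morph t tD t0.
congr complex.Re; under eq_bigr do rewrite mxE tE.
rewrite exchange_big /=; apply: eq_bigr => j _.
by rewrite mxE tE; apply: eq_bigr => i _; rewrite !mxE tC.
Qed.

Lemma trace_proj_oplus (t : {ptws A -> R[i]^o}) (p q : projection A) :
  trace_proj t (oplus p q) = trace_proj t p + trace_proj t q.
Proof.
rewrite /trace_proj /= big_split_ord /= -raddfD /=.
by congr complex.Re; congr (_ + _); apply: eq_bigr => k _;
  rewrite ?block_mxEul ?block_mxEdr.
Qed.

Lemma rhoE (t : {ptws A -> R[i]^o}) (p q : projection A) : tracial_states t ->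
  rho (K0_class p - K0_class q) t = trace_proj t p - trace_proj t q.
Proof.
move=> Tt; rewrite /rho /K0_class -grothE.
set g := groth_class _; have /groth_classP/asboolP[k] := groth_classK g.
case: (repr g) => a b /=.
have cE r : trace_proj t (repr (mvn_class r)) = trace_proj t r.
  by apply: trace_proj_mvn => //; apply/mvn_classP; rewrite mvn_classK.
rewrite -{1}(mvn_classK a) -{1}(mvn_classK b) -(mvn_classK k) -!mvn_classD.
move=> /mvn_classP/(trace_proj_mvn Tt); rewrite !trace_proj_oplus !cE.
by move=> /addIr e; apply/eqP; rewrite subr_eq addrAC eq_sym subr_eq e.
Qed.

(* rho_A(K_0(A)) is uniformly dense in Aff(T(A)).  A homeomorphism alpha is
   rigid when this holds for A = C*(X, alpha). *)
Definition rho_dense :=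
  forall h, @Aff_T R A h -> forall e : R, 0 < e ->
    exists g : K0, forall t, tracial_states t -> `|rho g t - h t| < e.

End K0.

(* Main.v *)
Require Import Defs.
From mathcomp Require Import all_boot all_order all_algebra.
From mathcomp Require Import complex.
From mathcomp Require Import all_classical all_reals all_analysis.
From mathcomp Require Import ring lra.

(** Write K for the Cantor space, X for the product of K and Omega, and A for
    the crossed product.

    The proof turns a function on X into an element of K_0(A) in three moves.
    A continuous affine function h on T(A) is first replaced by t |-> t(f) for
    a real f in C(X): finite-dimensional separation of the compact convex graph
    of h from its translate shows that any family of elements separating the
    traces suffices ([affine_approx]), and C(X) separates them because a trace
    of A kills f u^n for n <> 0 ([trace_determined]).  It is then enough to
    approximate t(f), for f >= 0, by the traces of a projection.

    A difference of projection classes has integer coefficients, whereas real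
    rank zero by itself only yields real combinations of projections.  The
    remedy is to concentrate f before approximating it.  As Omega is connected,
    alpha covers a minimal, hence aperiodic, homeomorphism of K, so some
    nonempty clopen subset U of K has N disjoint translates, and
    t(1_U) <= 1/N for every trace ([small_clopen]).  By minimality finitely
    many translates of U cover K; moving the pieces of f back over U gives
    F >= 0 supported over U with t(F) = t(f) for all t ([sweep]).  The function
    F may be large, but replacing it by an integer-valued one costs only a
    multiple of t(1_U).

    That replacement is made layer by layer ([layered_projection]): F is
    the sum of the functions min(1, max(0, F - k)), and real rank zero provides,
    near F - k - 3/2, an invertible selfadjoint b whose positive spectral
    projection has trace between those of neighbouring layers
    ([cut_real], from [spectral_cut]).

    The functional calculus behind this reduces to square roots of 1 - x
    for a selfadjoint x of norm < 1 ([sqrt_near1]).  They give the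
    boundedness of positive functionals ([tr_norm_le]) and the sign of an
    invertible selfadjoint element ([sign_polar]). *)

Set Implicit Arguments.
Unset Strict Implicit.
Unset Printing Implicit Defensive.

Import Order.TTheory GRing.Theory Num.Theory.
Import numFieldNormedType.Exports.

Local Open Scope classical_set_scope.
Local Open Scope ring_scope.
Local Open Scope complex_scope.

(** * Square roots and signs in a C*-algebra *)

Section CStarNorm.
Variables (R : realType) (A : cstarAlgType R).
Implicit Types (a b x y z : A) (r e : R).

Lemma starN a : star (- a) = - star a.
Proof. by rewrite -scaleN1r starZ rmorphN rmorph1 scaleN1r. Qed.

Lemma starB a b : star (a - b) = star a - star b.
Proof. by rewrite starD starN. Qed.

Lemma star1 : star (1 : A) = 1.
Proof. by have := starM (star 1 : A) 1; rewrite mulr1 !starK mulr1 => <-. Qed.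

Lemma starZr r a : star (r%:C *: a) = r%:C *: star a.
Proof. by rewrite starZ; congr (_ *: _); exact: conjc_real. Qed.

Lemma starX a n : star (a ^+ n) = star a ^+ n.
Proof. by elim: n => [|n IH]; rewrite ?star1 // exprSr exprS starM IH. Qed.

Lemma cnorm0 : cnorm (0 : A) = 0.
Proof.
apply: complexI.
by rewrite -(scale0r (0 : A)) cnormZ normr0 mul0r.
Qed.

Lemma cnormZr r a : cnorm (r%:C *: a) = `|r| * cnorm a.
Proof.
apply: complexI.
by rewrite cnormZ normc_def /= expr0n /= addr0 sqrtr_sqr -rmorphM.
Qed.

Lemma cnormN a : cnorm (- a) = cnorm a.
Proof. by apply: complexI; rewrite -scaleN1r cnormZ normrN1 mul1r. Qed.

Lemma cnorm_ge0 a : 0 <= cnorm a.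
Proof. by have := cnormD a (- a); rewrite subrr cnorm0 cnormN -mulr2n pmulrn_lge0. Qed.

Lemma cnormBC a b : cnorm (a - b) = cnorm (b - a).
Proof. by rewrite -cnormN opprB. Qed.

Lemma cnormi a : cnorm ('i *: a) = cnorm a.
Proof.
apply: complexI; rewrite cnormZ normc_def /= expr0n expr1n /= add0r sqrtr1.
by rewrite mul1r.
Qed.

(** The C*-identity bounds the square of the norm of [a] by the norms of
    [star a] and [a], so the adjoint is isometric. *)
Lemma cnorm_le_star a : cnorm a <= cnorm (star a).
Proof.
have [->|a0] := eqVneq (cnorm a) 0; first exact: cnorm_ge0.
have ap : 0 < cnorm a by rewrite lt_neqAle eq_sym a0 cnorm_ge0.
by rewrite -(ler_pM2r ap) -expr2 -cnorm_star cnormM.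
Qed.

Lemma cnorm_starE a : cnorm (star a) = cnorm a.
Proof.
by apply/eqP; rewrite eq_le cnorm_le_star -{2}(starK a) cnorm_le_star.
Qed.

Lemma cnorm_le_eps a (C : R) : (forall e, 0 < e -> cnorm a <= C * e) -> a = 0.
Proof.
move=> H; apply: cnorm_eq0; apply/eqP; rewrite eq_le cnorm_ge0 andbT.
apply/ler_addgt0Pr => e e0; rewrite add0r.
have C1 : 0 < `|C| + 1 by rewrite ltr_wpDl.
apply: (le_trans (H (e / (`|C| + 1)) _)); first exact: divr_gt0.
rewrite mulrCA ger_pMr // ler_pdivrMr // mul1r.
by rewrite (le_trans (ler_norm C)) // lerDl.
Qed.

Lemma cnorm_sqr x : star x = x -> cnorm (x ^+ 2) = cnorm x ^+ 2.
Proof. by move=> sx; rewrite -cnorm_star sx expr2. Qed.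

Lemma cnorm1 : cnorm (1 : A) = 1.
Proof.
have := cnorm_sqr star1; rewrite expr1n => /eqP.
rewrite -subr_eq0 expr2 -{1}(mulr1 (cnorm 1)) -mulrBr mulf_eq0 subr_eq0.
case/orP => /eqP // /cnorm_eq0/eqP; by rewrite oner_eq0.
Qed.

Lemma cnormXn x n : cnorm (x ^+ n) <= cnorm x ^+ n.
Proof.
elim: n => [|n IH]; first by rewrite !expr0 cnorm1.
rewrite !exprS (le_trans (cnormM _ _)) // ler_wpM2l //; exact: cnorm_ge0.
Qed.

(** A fixed point y of y |-> (x + y^2) / 2 satisfies (1 - y)^2 = 1 - x.  For
    x of norm below 1, the map is a contraction on the polynomials in x of norm
    at most that of x. *)
Fixpoint sqrt_iter x (n : nat) : A :=
  if n is m.+1 then (2^-1)%:C *: (x + sqrt_iter x m ^+ 2) else 0.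

Lemma sqrt_iter_sa x n : star x = x -> star (sqrt_iter x n) = sqrt_iter x n.
Proof.
move=> sx; elim: n => [|n IH] /=; first by rewrite star0.
by rewrite starZr starD sx starX IH.
Qed.

Lemma sqrt_iter_comm x z n : GRing.comm z x -> GRing.comm z (sqrt_iter x n).
Proof.
move=> zx; elim: n => [|n IH] /=; first exact: commr0.
by rewrite /GRing.comm -scalerAr -scalerAl (commrD zx (commrX 2 IH)).
Qed.

Lemma sqrt_iter_le x n : cnorm x < 1 -> cnorm (sqrt_iter x n) <= cnorm x.
Proof.
move=> x1; have x0 := cnorm_ge0 x; elim: n => [|n IH] /=; first by rewrite cnorm0.
rewrite cnormZr ger0_norm ?invr_ge0 // ler_pdivrMl //.
rewrite (le_trans (cnormD _ _)) // mulr2n mulrDl mul1r lerD2l.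
rewrite (le_trans (cnormXn _ _)) // expr2.
by rewrite (le_trans _ (ler_piMr x0 (ltW x1))) // ler_pM // cnorm_ge0.
Qed.

Lemma sqrt_iter_step x n : cnorm x < 1 ->
  cnorm (sqrt_iter x n.+1 - sqrt_iter x n) <= cnorm x ^+ n.
Proof.
move=> x1; have x0 := cnorm_ge0 x.
elim: n => [|n IH].
  by rewrite /= subr0 expr0 (le_trans (@sqrt_iter_le x 1 x1)) // ltW.
set y := sqrt_iter x n in IH *; set y1 := sqrt_iter x n.+1 in IH *.
have -> : sqrt_iter x n.+2 - y1 = (2^-1)%:C *: ((y1 - y) * (y1 + y)).
  rewrite [sqrt_iter x n.+2]/= -/y1 {2}/y1 /= -/y -scalerBr opprD addrACA subrr add0r.
  have c : GRing.comm y1 y.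
    by apply: sqrt_iter_comm; apply/commr_sym/sqrt_iter_comm.
  by rewrite mulrDr !mulrBl -c subrKA -!expr2.
rewrite cnormZr ger0_norm ?invr_ge0 // ler_pdivrMl //.
rewrite (le_trans (cnormM _ _)) // exprSr mulrCA ler_pM ?cnorm_ge0 //.
by rewrite (le_trans (cnormD _ _)) // mulr2n mulrDl !mul1r lerD // sqrt_iter_le.
Qed.

Lemma sqrt_iter_diff x n k : cnorm x < 1 ->
  cnorm (sqrt_iter x (n + k) - sqrt_iter x n) * (1 - cnorm x) <=
  cnorm x ^+ n - cnorm x ^+ (n + k).
Proof.
move=> x1; have x0 := cnorm_ge0 x; have sx : 0 <= 1 - cnorm x by rewrite subr_ge0 ltW.
elim: k => [|k IH]; first by rewrite addn0 !subrr cnorm0 mul0r.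
rewrite addnS -(subrKA (sqrt_iter x (n + k))).
rewrite (le_trans (ler_wpM2r sx (cnormD _ _))) // mulrDl.
apply: (le_trans (lerD (ler_wpM2r sx (sqrt_iter_step (n + k) x1)) IH)).
by rewrite mulrBr mulr1 -exprSr addrC subrKA.
Qed.

Lemma expr_lt_eps r e : 0 <= r < 1 -> 0 < e ->
  exists N, forall n, (N <= n)%N -> r ^+ n < e.
Proof.
move=> /andP[r0 r1] e0.
have /cvgrPdist_lt/(_ _ e0)[N _ HN] : (fun n => r ^+ n) @ \oo --> (0 : R).
  by apply: cvg_expr; rewrite ger0_norm.
by exists N => n /HN; rewrite sub0r normrN ger0_norm // exprn_ge0.
Qed.

(** This is the only functional calculus that the proof needs; the commutation
    clause replaces the fact that y is a limit of polynomials in x. *)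
Lemma sqrt_near1 x : star x = x -> cnorm x < 1 ->
  exists y, [/\ star y = y, cnorm y <= cnorm x, (1 - y) ^+ 2 = 1 - x &
    forall z, GRing.comm z x -> GRing.comm z y].
Proof.
move=> sx x1; have x0 := cnorm_ge0 x.
have rx : 0 < 1 - cnorm x by rewrite subr_gt0.
have [|y Hy] := @cnorm_complete _ _ (sqrt_iter x).
  move=> e e0.
  have [N HN] := @expr_lt_eps (cnorm x) (e * (1 - cnorm x))
    (introT andP (conj x0 x1)) (mulr_gt0 e0 rx).
  suff H m k : (N <= m)%N -> cnorm (sqrt_iter x (m + k) - sqrt_iter x m) < e.
    exists N => m n Nm Nn; case/orP: (leq_total m n) => /subnKC <-; last exact: H.
    by rewrite cnormBC; exact: H.
  move=> /HN xm; rewrite -(ltr_pM2r rx) (le_lt_trans (sqrt_iter_diff m k x1)) //.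
  by rewrite (le_lt_trans _ xm) // gerBl exprn_ge0.
have Hy1 e : 0 < e ->
    exists n, cnorm (sqrt_iter x n - y) < e /\ cnorm (sqrt_iter x n.+1 - y) < e.
  by move=> /Hy[N HN]; exists N; split; apply: HN.
have ny : cnorm y <= cnorm x.
  apply/ler_addgt0Pr => e /Hy1[n [+ _]]; rewrite cnormBC => /ltW ln.
  by rewrite -(subrK (sqrt_iter x n) y) (le_trans (cnormD _ _)) // addrC lerD // sqrt_iter_le.
exists y; split => //.
- apply/eqP; rewrite -subr_eq0; apply/eqP; apply: (@cnorm_le_eps _ 2) => e /Hy1[n [ln _]].
  rewrite -(subrKA (sqrt_iter x n)) (le_trans (cnormD _ _)) // mulr2n mulrDl mul1r.
  apply: lerD; last exact: ltW.
  by rewrite -(sqrt_iter_sa n sx) -starB cnorm_starE cnormBC ltW.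
- have E : y = (2^-1)%:C *: (x + y ^+ 2).
    apply/eqP; rewrite -subr_eq0; apply/eqP.
    apply: (@cnorm_le_eps _ 2) => e /Hy1[n [ln ln1]].
    rewrite -(subrKA (sqrt_iter x n.+1)) (le_trans (cnormD _ _)) // mulr2n mulrDl mul1r.
    apply: lerD; first by rewrite cnormBC ltW.
    rewrite /= -scalerBr opprD addrACA subrr add0r cnormZr ger0_norm ?invr_ge0 //.
    rewrite ler_pdivrMl // mulr2n mulrDl mul1r.
    rewrite !expr2 -(subrKA (sqrt_iter x n * y)) -mulrBr -mulrBl.
    rewrite (le_trans (cnormD _ _)) // lerD // (le_trans (cnormM _ _)) //.
      rewrite -(mul1r e) ler_pM ?cnorm_ge0 //; last exact: ltW.
      by rewrite (le_trans (sqrt_iter_le n x1)) // ltW.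
    rewrite -(mulr1 e) ler_pM ?cnorm_ge0 //; first exact: ltW.
    by rewrite (le_trans ny) // ltW.
  have {}E : y + y = x + y ^+ 2.
    rewrite {1 2}E -scalerDl -rmorphD /=.
    have -> : (2^-1 + 2^-1 : R) = 1 by lra.
    by rewrite scale1r.
  have -> : (1 - y) ^+ 2 = 1 - (y + y) + y ^+ 2.
    by rewrite expr2 mulrBl mul1r mulrBr mulr1 -expr2 opprB opprD !addrA [RHS]addrAC.
  by rewrite E opprD addrA addrNK.
- move=> z zx; apply/eqP; rewrite -subr_eq0; apply/eqP.
  apply: (@cnorm_le_eps _ (2 * cnorm z)) => e /Hy1[n [ln _]].
  have c := sqrt_iter_comm n zx.
  rewrite -(subrKA (z * sqrt_iter x n)) -mulrBr c -mulrBl.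
  have -> : 2 * cnorm z * e = cnorm z * e + cnorm z * e by ring.
  rewrite (le_trans (cnormD _ _)) // lerD // (le_trans (cnormM _ _)) //.
    by rewrite ler_wpM2l ?cnorm_ge0 // cnormBC ltW.
  by rewrite mulrC ler_wpM2l ?cnorm_ge0 // ltW.
Qed.

(** The element y + i z is a multiple of a unitary, and y is its real part. *)
Lemma sum_sqr_cnorm_le y z r : star y = y -> star z = z -> GRing.comm y z ->
  0 <= r -> y ^+ 2 + z ^+ 2 = (r ^+ 2)%:C *: 1 -> cnorm y <= r.
Proof.
move=> sy sz yz r0 E; pose w := y + 'i *: z.
have sw : star w = y - 'i *: z.
  rewrite /w starD sy starZ sz -scaleNr; congr (_ + _ *: _).
  by apply/eqP; rewrite eq_complex /= oppr0 !eqxx.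
have ww : star w * w = (r ^+ 2)%:C *: 1.
  rewrite sw /w mulrDr !mulrBl -!scalerAl -!scalerAr -yz addrACA -!expr2 -E.
  rewrite scalerA -expr2 sqr_i scaleN1r opprK.
  by rewrite addrA addrK.
have nw : cnorm w = r.
  apply/eqP; rewrite -(@eqrXn2 _ 2) ?cnorm_ge0 // -cnorm_star ww cnormZr cnorm1 mulr1.
  by rewrite ger0_norm // sqr_ge0.
have -> : y = (2^-1)%:C *: (star w + w).
  rewrite sw /w addrACA addNr addr0 scalerDr -scalerDl -rmorphD /=.
  have -> : (2^-1 + 2^-1 : R) = 1 by lra.
  by rewrite scale1r.
rewrite cnormZr ger0_norm ?invr_ge0 // ler_pdivrMl //.
by rewrite (le_trans (cnormD _ _)) // cnorm_starE nw mulr2n mulrDl mul1r.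
Qed.

Lemma inverse_sa b c : star b = b -> c * b = 1 -> b * c = 1 -> star c = c.
Proof.
move=> sb cb bc; have scb : star c * b = 1 by rewrite -{1}sb -starM bc star1.
by rewrite -[LHS]mulr1 -bc mulrA scb mul1r.
Qed.

(** If d is so small that d c has norm below 1, then b^2 - d^2 = (b s)^2 with
    s^2 = 1 - d^2 c^2.  With y^2 = 1 - b^2 this gives y^2 + (b s)^2 = 1 - d^2,
    whence the strict bound. *)
Lemma cnorm_1Bsqr_lt1 b c : star b = b -> c * b = 1 -> b * c = 1 ->
  cnorm b < 1 -> cnorm (1 - b ^+ 2) < 1.
Proof.
move=> sb cb bc b1; have sc := inverse_sa sb cb bc.
have c0 := cnorm_ge0 c; pose d := (cnorm c + 1)^-1.
have d0 : 0 < d by rewrite invr_gt0 ltr_wpDl.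
have d1 : d <= 1 by rewrite invf_le1 ?ltr_wpDl // lerDr.
have dc : d * cnorm c < 1 by rewrite mulrC ltr_pdivrMr ?ltr_wpDl // mul1r ltrDl.
have d2 : d ^+ 2 <= 1 by rewrite expr_le1 // ltW.
pose x := (d ^+ 2)%:C *: c ^+ 2.
have sx : star x = x by rewrite /x starZr starX sc.
have x1 : cnorm x < 1.
  rewrite /x cnormZr cnorm_sqr // ger0_norm ?sqr_ge0 // -exprMn.
  by rewrite expr_lt1 // mulr_ge0 // ltW.
have [y1 [sy1 _ Ey1 cy1]] := sqrt_near1 sx x1.
have [||y0 [sy0 _ Ey0 cy0]] := @sqrt_near1 (b ^+ 2); first by rewrite starX sb.
  by rewrite cnorm_sqr // expr_lt1 // cnorm_ge0.
have bcc : GRing.comm b c by rewrite /GRing.comm bc cb.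
have bx : GRing.comm b x.
  by rewrite /GRing.comm /x -scalerAr -scalerAl (commrX 2 bcc).
have by1 : GRing.comm b (1 - y1) by apply: commrB; [exact: commr1|exact: cy1].
have sy : star (1 - y0) = 1 - y0 by rewrite starB star1 sy0.
have y1b2 : GRing.comm (1 - y1) (b ^+ 2) by apply/commrX/commr_sym.
have y1y0 : GRing.comm (1 - y0) (1 - y1).
  by apply: commr_sym; apply: commrB; [exact: commr1|exact: cy0].
have by0 : GRing.comm b (1 - y0).
  by apply: commrB; [exact: commr1|apply: cy0; exact: commrX].
have := @sum_sqr_cnorm_le (1 - y0) (b * (1 - y1)) (Num.sqrt (1 - d ^+ 2)).
have dd : 0 <= 1 - d ^+ 2 by rewrite subr_ge0.
rewrite sqr_sqrtr // => /(_ sy) H.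
rewrite -Ey0 cnorm_sqr //.
apply: (@le_lt_trans _ _ (1 - d ^+ 2)); last by rewrite gtrBl exprn_gt0.
rewrite -[leRHS]sqr_sqrtr // lerXn2r ?nnegrE ?cnorm_ge0 ?sqrtr_ge0 //.
apply: H.
- by rewrite starM starB star1 sy1 sb by1.
- by apply: commrM => //; exact: commr_sym.
- exact: sqrtr_ge0.
- rewrite Ey0 exprMn_comm // Ey1 /x mulrBr mulr1 -scalerAr.
  by rewrite -exprMn_comm // bc expr1n subrKA rmorphB /= scalerBl scale1r.
Qed.

(** Polar decomposition of an invertible selfadjoint element: [s] is its sign and
    [q ^+ 2] its absolute value.  After rescaling b to z of norm below 1,
    1 - z^2 has norm below 1, so |z| is a square root of
    z^2 = 1 - (1 - z^2); it lies within distance 1 of the identity, so it is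
    itself a square.  The sign is |z| z^-1. *)
Lemma sign_polar b c : star b = b -> c * b = 1 -> b * c = 1 ->
  exists s q : A, [/\ star s = s, s ^+ 2 = 1, star q = q, GRing.comm s q &
                   b = s * q ^+ 2].
Proof.
move=> sb cb bc; have sc := inverse_sa sb cb bc.
have b0 := cnorm_ge0 b; pose l := (cnorm b + 1)^-1.
have l0 : 0 < l by rewrite invr_gt0 ltr_wpDl.
have lV : l * l^-1 = 1 by rewrite divff // gt_eqF.
pose z := l%:C *: b; pose v := (l^-1)%:C *: c.
have sz : star z = z by rewrite /z starZr sb.
have sv : star v = v by rewrite /v starZr sc.
have zv : z * v = 1.
  by rewrite /z /v -scalerAl -scalerAr scalerA -rmorphM /= lV bc scale1r.
have vz : v * z = 1.
  by rewrite /z /v -scalerAl -scalerAr scalerA -rmorphM /= mulrC lV cb scale1r.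
have z1 : cnorm z < 1.
  rewrite /z cnormZr gtr0_norm // mulrC ltr_pdivrMr ?ltr_wpDl // mul1r ltrDl //.
have [||y [sy ny Ey cy]] := @sqrt_near1 (1 - z ^+ 2).
- by rewrite starB star1 starX sz.
- exact: cnorm_1Bsqr_lt1 zv z1.
rewrite subKr in Ey.
have [//||y' [sy' _ Ey' cy']] := @sqrt_near1 y.
  exact: le_lt_trans ny (cnorm_1Bsqr_lt1 sz vz zv z1).
have vz2 : GRing.comm v (z ^+ 2) by apply: commrX; rewrite /GRing.comm vz zv.
have vy : GRing.comm v y by apply: cy; apply: commrB => //; exact: commr1.
have vy' : GRing.comm v y' by exact: cy'.
have yy' : GRing.comm y y' by exact: cy'.
have vq : GRing.comm v (1 - y) by apply: commrB => //; exact: commr1.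
exists ((1 - y) * v), ((Num.sqrt l^-1)%:C *: (1 - y')); split.
- by rewrite starM sv starB sy star1 vq.
- rewrite exprMn_comm; last exact: commr_sym.
  rewrite Ey -exprMn_comm; first by rewrite zv expr1n.
  by rewrite /GRing.comm vz zv.
- by rewrite starZr starB sy' star1.
- rewrite /GRing.comm -scalerAr -scalerAl; congr (_ *: _).
  apply: commr_sym; apply: commrM.
    apply: commrB; first exact: commr1.
    by apply: commr_sym; apply: commrB; [exact: commr1|].
  by apply: commr_sym; apply: commrB; [exact: commr1|].
- have -> : ((Num.sqrt l^-1)%:C *: (1 - y')) ^+ 2 = (l^-1)%:C *: (1 - y).
    rewrite expr2 -scalerAl -scalerAr scalerA -rmorphM /= -!expr2 Ey'.
    by rewrite sqr_sqrtr // invr_ge0 ltW.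
  rewrite -scalerAr.
  rewrite -mulrA vq mulrA -expr2 Ey expr2 -mulrA zv mulr1 /z scalerA.
  by rewrite -rmorphM /= mulrC lV scale1r.
Qed.
End CStarNorm.

(** * Tracial states and spectral cuts *)

Section Trace.
Variables (R : realType) (A : cstarAlgType R).
Implicit Types (t : {ptws A -> R[i]^o}) (a b : A) (r : R).

(** Passing to the real part loses nothing: the imaginary part of t(a) is
    minus the real part of t(i a). *)
Definition tr t a : R := complex.Re (t a).

Section OneTrace.
Variable t : {ptws A -> R[i]^o}.
Hypothesis Tt : tracial_states t.

Lemma tracialD a b : t (a + b) = t a + t b.
Proof. by case: Tt => tl _ _ _; have := tl 1 a b; rewrite !scale1r. Qed.

Lemma tracial0 : t 0 = 0.
Proof. by apply: (addrI (t 0)); rewrite -tracialD !addr0. Qed.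

Lemma tracialZ (c : R[i]) a : t (c *: a) = c * t a.
Proof. by case: Tt => tl _ _ _; have := tl c a 0; rewrite !addr0 tracial0 addr0. Qed.

Lemma trD a b : tr t (a + b) = tr t a + tr t b.
Proof. by rewrite /tr tracialD raddfD. Qed.

Lemma tr0 : tr t 0 = 0.
Proof. by rewrite /tr tracial0. Qed.

Lemma trN a : tr t (- a) = - tr t a.
Proof. by rewrite /tr -scaleN1r tracialZ mulN1r raddfN. Qed.

Lemma trB a b : tr t (a - b) = tr t a - tr t b.
Proof. by rewrite trD trN. Qed.

Lemma trZ r a : tr t (r%:C *: a) = r * tr t a.
Proof. by rewrite /tr tracialZ; case: (t a) => x y /=; rewrite mul0r subr0. Qed.

Lemma tr1 : tr t 1 = 1.
Proof. by case: Tt => _ _ t1 _; rewrite /tr t1. Qed.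

Lemma trC a b : tr t (a * b) = tr t (b * a).
Proof. by case: Tt => _ _ _ tC; rewrite /tr tC. Qed.

Lemma tr_sum I (s : seq I) (F : I -> A) :
  tr t (\sum_(i <- s) F i) = \sum_(i <- s) tr t (F i).
Proof. exact: (big_morph _ trD tr0). Qed.

Lemma tr_star_ge0 a : 0 <= tr t (star a * a).
Proof. by case: Tt => _ tp _ _; have := tp a; rewrite lecE => /andP[]. Qed.

Lemma tr_sqr_ge0 a : star a = a -> 0 <= tr t (a ^+ 2).
Proof. by move=> sa; rewrite expr2 -{1}sa tr_star_ge0. Qed.

(** For such [a], [1 - a] is a square of a selfadjoint element. *)
Lemma tracial_lt1 a : star a = a -> cnorm a < 1 -> tr t a <= 1 /\ complex.Im (t a) = 0.
Proof.
move=> sa a1; have [y [sy _ Ey _]] := sqrt_near1 sa a1.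
have Ea : a = 1 + (-1) *: (star (1 - y) * (1 - y)).
  by rewrite starB star1 sy -expr2 Ey scaleN1r opprB addrC subrK.
case: Tt => _ tp t1 _; have := tp (1 - y); rewrite lecE => /andP[/eqP im re].
rewrite /tr Ea tracialD tracialZ t1 mulN1r; split.
  by rewrite raddfB /= gerBl.
by rewrite raddfB /= im subrr.
Qed.

Lemma tracial_sa a : star a = a -> tr t a <= cnorm a /\ complex.Im (t a) = 0.
Proof.
move=> sa; suff H r : cnorm a < r -> tr t a <= r /\ complex.Im (t a) = 0.
  split; last by apply: (H (cnorm a + 1) _).2; rewrite ltrDl.
  by apply/ler_addgt0Pr => e e0; apply: (H _ _).1; rewrite ltrDl.
move=> ar; have r0 : 0 < r := le_lt_trans (cnorm_ge0 a) ar.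
have [||+ +] := @tracial_lt1 ((r^-1)%:C *: a).
- by rewrite starZr sa.
- by rewrite cnormZr gtr0_norm ?invr_gt0 // ltr_pdivrMl // mulr1.
rewrite trZ ler_pdivrMl // mulr1 => -> /eqP im; split=> //; apply/eqP; move: im.
rewrite tracialZ; case: (t a) => x y /=.
by rewrite mul0r addr0 mulf_eq0 invr_eq0 gt_eqF.
Qed.

(** On selfadjoint elements this is positivity; the real part of t(a) is the value
    of t at the selfadjoint part of [a], whose norm is at most that of [a]. *)
Lemma tr_norm_le a : `|tr t a| <= cnorm a.
Proof.
suff H b : tr t b <= cnorm b.
  by rewrite ler_norml H andbT lerNl -trN -cnormN H.
pose x := (2^-1)%:C *: (b + star b); pose y := (2^-1)%:C *: ('i *: (star b - b)).
have sx : star x = x by rewrite /x starZr starD starK addrC.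
have sy : star y = y.
  rewrite /y starZr starZ starB starK -opprB scalerN -scaleNr; congr (_ *: (_ *: _)).
  by apply/eqP; rewrite eq_complex /= opprK oppr0 !eqxx.
have Eb : b = x + 'i *: y.
  rewrite /x /y !scalerA mulrAC -expr2 sqr_i mulN1r scaleNr -scalerBr opprB.
  rewrite [X in _ *: X]addrACA subrr addr0 scalerDr -scalerDl -rmorphD /=.
  have -> : (2^-1 + 2^-1 : R) = 1 by lra.
  by rewrite scale1r.
have -> : tr t b = tr t x.
  have [_ iy] := tracial_sa sy.
  rewrite Eb trD {2}/tr tracialZ; case: (t y) iy => y1 y2 /= ->.
  by rewrite mul0r mulr0 subrr addr0.
have [+ _] := tracial_sa sx; move=> /le_trans; apply.
rewrite /x cnormZr ger0_norm ?invr_ge0 // ler_pdivrMl //.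
by rewrite (le_trans (cnormD _ _)) // cnorm_starE mulr2n mulrDl mul1r.
Qed.

Lemma proj_cnorm_le1 (p : A) : star p = p -> p ^+ 2 = p -> cnorm p <= 1.
Proof.
move=> sp pp; have := cnorm_sqr sp; rewrite pp; have := cnorm_ge0 p.
move=> p0 e; rewrite leNgt; apply/negP => p1.
have : cnorm p < cnorm p ^+ 2 by rewrite expr2 ltr_pMr // (lt_trans _ p1).
by rewrite -e ltxx.
Qed.

Lemma tr_proj_sqr_ge0 (p k : A) : star p = p -> p ^+ 2 = p -> star k = k ->
  0 <= tr t (p * k ^+ 2).
Proof.
move=> sp pp sk; rewrite expr2 mulrA trC -{1}pp expr2.
have -> : k * (p * p * k) = star (p * k) * (p * k) by rewrite starM sp sk !mulrA.
exact: tr_star_ge0.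
Qed.

(** A projection [p] on which [b] is positive is almost orthogonal, for the trace,
    to any [h] living where [g] is at most -1/2, provided that [g] is close to
    [b]: t(p b h^2) >= 0 whereas t(p g h^2) <= - t(p h^2) / 2. *)
Lemma trace_cut (p r b g h k : A) : star p = p -> p ^+ 2 = p -> star r = r ->
  star h = h -> star k = k -> p * b = r * p * r ->
  - (g * h ^+ 2) - (2^-1)%:C *: h ^+ 2 = k ^+ 2 ->
  tr t (p * h ^+ 2) <= 2 * (cnorm (g - b) * cnorm (h ^+ 2)).
Proof.
move=> sp pp sr sh sk pb gk.
have := tr_proj_sqr_ge0 sp pp sk.
rewrite -gk mulrBr mulrN trB trN -scalerAr trZ [p * (g * _)]mulrA.
have -> : p * g * h ^+ 2 = p * b * h ^+ 2 + p * (g - b) * h ^+ 2.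
  by rewrite mulrBr mulrBl addrC subrK.
rewrite trD.
have : 0 <= tr t (p * b * h ^+ 2).
  rewrite pb expr2 mulrA trC -{1}pp expr2.
  have -> : h * (r * (p * p) * r * h) = star (p * r * h) * (p * r * h).
    by rewrite !starM sp sr sh !mulrA.
  exact: tr_star_ge0.
have : `|tr t (p * (g - b) * h ^+ 2)| <= cnorm (g - b) * cnorm (h ^+ 2).
  rewrite (le_trans (tr_norm_le _)) // (le_trans (cnormM _ _)) // ler_wpM2r ?cnorm_ge0 //.
  by rewrite (le_trans (cnormM _ _)) // ler_piMl ?cnorm_ge0 // proj_cnorm_le1.
by rewrite ler_norml => /andP[]; lra.
Qed.

End OneTrace.

(** [p] is the spectral projection of [b] on the positive half-line, (1 + s) / 2 for
    s the sign of [b].  Both halves are instances of [trace_cut], the second for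
    [1 - p] and [- b]. *)
Lemma spectral_cut (b c : A) : star b = b -> c * b = 1 -> b * c = 1 ->
  exists p : A, [/\ star p = p, p ^+ 2 = p &
  forall t, tracial_states t -> forall g h k, star h = h -> star k = k ->
   (- (g * h ^+ 2) - (2^-1)%:C *: h ^+ 2 = k ^+ 2 ->
     tr t (p * h ^+ 2) <= 2 * (cnorm (g - b) * cnorm (h ^+ 2))) /\
   (g * h ^+ 2 - (2^-1)%:C *: h ^+ 2 = k ^+ 2 ->
     tr t ((1 - p) * h ^+ 2) <= 2 * (cnorm (g - b) * cnorm (h ^+ 2)))].
Proof.
move=> sb cb bc; have [s [q [ss s2 sq sqc Eb]]] := sign_polar sb cb bc.
pose P (u : A) : A := (2^-1)%:C *: (1 + u).
have PP u : u ^+ 2 = 1 -> P u ^+ 2 = P u.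
  move=> u2; rewrite /P expr2 -scalerAl -scalerAr mulrDr !mulrDl !mul1r mulr1 -expr2 u2.
  have -> : 1 + u + (u + 1) = (2 : R)%:C *: (1 + u).
    by rewrite (addrC u 1) [(2 : R)%:C]rmorphD scalerDl scale1r.
  by rewrite !scalerA -!rmorphM /=; congr (_%:C *: _); lra.
have sP u : star u = u -> star (P u) = P u by move=> su; rewrite /P starZr starD star1 su.
have Pu u : u ^+ 2 = 1 -> GRing.comm u q -> P u * (u * q ^+ 2) = q * P u * q.
  move=> u2 uq; rewrite /P -scalerAr -!scalerAl; congr (_ *: _).
  rewrite mulrA mulrDl mul1r -expr2 u2 (addrC u) expr2 mulrA; congr (_ * _).
  by apply: commr_sym; apply: commrD; [exact: commr1|exact: commr_sym].
have P1 : 1 - P s = P (- s).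
  have E : (1 : A) = P s + P (- s).
    rewrite /P -scalerDr addrACA subrr addr0 scalerDr -scalerDl -rmorphD /=.
    have -> : (2^-1 + 2^-1 : R) = 1 by lra.
    by rewrite scale1r.
  by rewrite {1}E addrAC subrr add0r.
exists (P s); split; [exact: sP|exact: PP|].
move=> t Tt g h k sh sk; split.
  by apply: (@trace_cut t Tt (P s) q b) => //; [exact: sP|exact: PP|rewrite Eb Pu].
have e2 : (- s) ^+ 2 = 1 by rewrite sqrrN.
have eq : GRing.comm (- s) q by rewrite /GRing.comm mulNr mulrN sqc.
rewrite P1 -(opprK g) mulNr => E; rewrite -opprD cnormN -[b]opprK.
apply: (@trace_cut t Tt (P (- s)) q) E => //; [by apply: sP; rewrite starN ss|exact: PP|].
by rewrite -(Pu _ e2 eq) Eb mulNr.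
Qed.
End Trace.

(** * Real functions inside C(X) *)

Section ComplexLine.
Variable R : realType.

Lemma ltc_normP (z : R[i]) (e : R) :
  (`|z| < e%:C) = (Num.sqrt (complex.Re z ^+ 2 + complex.Im z ^+ 2) < e).
Proof. by rewrite normc_def ltcR. Qed.

Lemma Re_le_normc (z : R[i]) :
  `|complex.Re z| <= Num.sqrt (complex.Re z ^+ 2 + complex.Im z ^+ 2).
Proof. by rewrite -sqrtr_sqr ler_wsqrtr // lerDl sqr_ge0. Qed.

Lemma Im_le_normc (z : R[i]) :
  `|complex.Im z| <= Num.sqrt (complex.Re z ^+ 2 + complex.Im z ^+ 2).
Proof. by rewrite -sqrtr_sqr ler_wsqrtr // lerDr sqr_ge0. Qed.

Lemma normc_le_ReIm (z : R[i]) :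
  Num.sqrt (complex.Re z ^+ 2 + complex.Im z ^+ 2) <=
  `|complex.Re z| + `|complex.Im z|.
Proof.
rewrite -[leRHS]ger0_norm ?addr_ge0 // -sqrtr_sqr ler_wsqrtr //.
rewrite -(real_normK (num_real (complex.Re z))) -(real_normK (num_real (complex.Im z))).
by rewrite sqrrD lerD2r lerDl mulrn_wge0 // mulr_ge0.
Qed.

Lemma Re_continuous : continuous (fun z : R[i]^o => complex.Re z).
Proof.
move=> z P /nbhs_ballP[e /= e0 eP]; apply/nbhs_ballP; exists e%:C; first by rewrite /= ltcR.
move=> w; rewrite -ball_normE /= ltc_normP => zw; apply: eP; rewrite -ball_normE /=.
by rewrite -raddfB (le_lt_trans (Re_le_normc _)).
Qed.

Lemma Im_continuous : continuous (fun z : R[i]^o => complex.Im z).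
Proof.
move=> z P /nbhs_ballP[e /= e0 eP]; apply/nbhs_ballP; exists e%:C; first by rewrite /= ltcR.
move=> w; rewrite -ball_normE /= ltc_normP => zw; apply: eP; rewrite -ball_normE /=.
by rewrite -raddfB (le_lt_trans (Im_le_normc _)).
Qed.

Lemma Complex_continuous : continuous (fun z : R * R => (z.1 +i* z.2)%C : R[i]^o).
Proof.
move=> z P /nbhs_ballP[e /= e0 eP].
have [er ei] : e = (complex.Re e)%:C /\ 0 < complex.Re e.
  by move: e0; rewrite ltcE => /andP[/eqP im re]; split=> //; case: (e) im => a b /= ->.
have e2 : 0 < complex.Re e / 2 by rewrite divr_gt0.
apply/nbhs_ballP; exists (complex.Re e / 2) => // w [w1 w2]; apply: eP.
move: w1 w2; rewrite -!ball_normE /= => w1 w2; rewrite er ltc_normP.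
by rewrite (le_lt_trans (normc_le_ReIm _)) //= [ltRHS]splitr ltrD.
Qed.

Lemma RtoC_continuous : continuous (fun x : R => x%:C : R[i]^o).
Proof.
move=> x P /nbhs_ballP[e /= e0 eP].
have [er ei] : e = (complex.Re e)%:C /\ 0 < complex.Re e.
  by move: e0; rewrite ltcE => /andP[/eqP im re]; split=> //; case: (e) im => a b /= ->.
apply/nbhs_ballP; exists (complex.Re e) => // w xw; apply: eP.
move: xw; rewrite -!ball_normE /= => xw; rewrite er -rmorphB /= ltc_normP /=.
by rewrite expr0n /= addr0 sqrtr_sqr.
Qed.
End ComplexLine.

Section RealFunctions.
Variables (R : realType) (X : topologicalType).
Implicit Types f g : X -> R.

Lemma realC_cts f : continuous f -> continuous (fun x => (f x)%:C : R[i]^o).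
Proof. by move=> cf x; apply: continuous_comp; [exact: cf|exact: RtoC_continuous]. Qed.

(** Total in [f], so that identities between real functions can be rewritten without
    continuity proofs inside the terms. *)
Definition realC f : Cfun R X :=
  if pselect (continuous f) is left cf then mkC (realC_cts cf) else 0.

Lemma realCE f x : continuous f -> Cval (realC f) x = (f x)%:C.
Proof. by rewrite /realC; case: pselect. Qed.

Definition clamp (y : R) : R := Num.min 1 (Num.max 0 y).

Lemma clamp_ge0 y : 0 <= clamp y.
Proof. by rewrite /clamp le_min ler01 le_max lexx. Qed.
Lemma clamp_le1 y : clamp y <= 1.
Proof. by rewrite /clamp ge_min lexx. Qed.

Lemma cts_clamp f : continuous f -> continuous (fun x => clamp (f x)).
Proof.
move=> cf x; rewrite /clamp.
apply: (@continuous_min R X (fun=> 1) (fun x => Num.max 0 (f x))); first exact: cvg_cst.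
by apply: (@continuous_max R X (fun=> 0) f); [exact: cvg_cst|exact: cf].
Qed.
Lemma cts_cst (r : R) : continuous (fun _ : X => r). Proof. by move=> x; exact: cvg_cst. Qed.
Lemma cts_add f g : continuous f -> continuous g -> continuous (fun x => f x + g x).
Proof. by move=> cf cg x; apply: cvgD; [exact: cf|exact: cg]. Qed.
Lemma cts_sub f g : continuous f -> continuous g -> continuous (fun x => f x - g x).
Proof. by move=> cf cg x; apply: cvgB; [exact: cf|exact: cg]. Qed.
Lemma cts_mul f g : continuous f -> continuous g -> continuous (fun x => f x * g x).
Proof. by move=> cf cg x; apply: cvgM; [exact: cf|exact: cg]. Qed.
Lemma cts_scale (r : R) f : continuous f -> continuous (fun x => r * f x).
Proof. by move=> cf; apply: cts_mul => //; exact: cts_cst. Qed.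
Lemma cts_sqr f : continuous f -> continuous (fun x => f x ^+ 2).
Proof. by move=> cf; exact: cts_mul. Qed.
Lemma cts_sqrt f : continuous f -> continuous (fun x => Num.sqrt (f x)).
Proof. by move=> cf x; apply: continuous_comp; [exact: cf|exact: sqrt_continuous]. Qed.
Lemma cts_sum I (r : seq I) (F : I -> X -> R) : (forall i, continuous (F i)) ->
  continuous (fun x => \sum_(i <- r) F i x).
Proof.
move=> cF; elim: r => [|i r IH].
  by under eq_fun do rewrite big_nil; exact: cts_cst.
by under eq_fun do rewrite big_cons; exact: cts_add.
Qed.
End RealFunctions.

Section RealPart.
Variables (R : realType) (X : topologicalType) (A : cstarAlgType R) (iota : Cfun R X -> A).
Hypothesis hom : Cfun_star_hom iota.
Implicit Types f g : X -> R.

Definition iotaR f : A := iota (realC f).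
Local Notation J := iotaR.

Lemma iota_add a b : iota (a + b) = iota a + iota b.
Proof. by case: hom => il _ _; have := il 1 a b; rewrite !scale1r. Qed.
Lemma iota_zero : iota 0 = 0.
Proof. by apply: (addrI (iota 0)); rewrite -iota_add !addr0. Qed.
Lemma iota_scale c a : iota (c *: a) = c *: iota a.
Proof. by case: hom => il _ _; have := il c a 0; rewrite !addr0 iota_zero addr0. Qed.
Lemma iota_mul a b : iota (a * b) = iota a * iota b.
Proof. by case: hom => _ [_ im] _; exact: im. Qed.
Lemma iota_one : iota 1 = 1.
Proof. by case: hom => _ [i1 _] _; exact: i1. Qed.

Lemma iotaR_star f : star (J f) = J f.
Proof.
case: hom => _ _ <-; congr iota; apply: Cfun_eqP => x.
rewrite /realC; case: pselect => cf; last exact: conjc0.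
exact: conjc_real.
Qed.
Lemma iotaR_add f g : continuous f -> continuous g -> J (fun x => f x + g x) = J f + J g.
Proof.
move=> cf cg; rewrite /iotaR -iota_add; congr iota; apply: Cfun_eqP => x.
by rewrite -[RHS]/(Cval (realC f) x + Cval (realC g) x) !realCE ?rmorphD //; exact: cts_add.
Qed.
Lemma iotaR_mul f g : continuous f -> continuous g -> J (fun x => f x * g x) = J f * J g.
Proof.
move=> cf cg; rewrite /iotaR -iota_mul; congr iota; apply: Cfun_eqP => x.
by rewrite -[RHS]/(Cval (realC f) x * Cval (realC g) x) !realCE ?rmorphM //; exact: cts_mul.
Qed.
Lemma iotaR_scale (r : R) f : continuous f -> J (fun x => r * f x) = r%:C *: J f.
Proof.
move=> cf; rewrite /iotaR -iota_scale; congr iota; apply: Cfun_eqP => x.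
by rewrite -[RHS]/(r%:C * Cval (realC f) x) !realCE ?rmorphM //; exact: cts_scale.
Qed.
Lemma iotaR_sub f g : continuous f -> continuous g -> J (fun x => f x - g x) = J f - J g.
Proof.
move=> cf cg; have -> : (fun x => f x - g x) = (fun x => f x + (-1) * g x).
  by apply/funext => x; rewrite mulN1r.
by rewrite iotaR_add ?iotaR_scale ?rmorphN1 ?scaleN1r //; exact: cts_scale.
Qed.
Lemma iotaR1 : J (fun=> 1) = 1.
Proof.
rewrite /iotaR -iota_one; congr iota; apply: Cfun_eqP => x.
by rewrite realCE; last exact: cts_cst.
Qed.
Lemma iotaR_sqr f : continuous f -> J (fun x => f x ^+ 2) = J f ^+ 2.
Proof. by move=> cf; rewrite expr2 -iotaR_mul. Qed.
Lemma iotaR_sqrt f : continuous f -> (forall x, 0 <= f x) ->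
  J (fun x => Num.sqrt (f x)) ^+ 2 = J f.
Proof.
move=> cf f0; rewrite -iotaR_sqr; last exact: cts_sqrt.
by congr J; apply/funext => x; rewrite sqr_sqrtr.
Qed.
Lemma iotaR0 : J (fun=> 0) = 0.
Proof.
have -> : (fun=> 0) = (fun _ : X => 0 * 1) :> (X -> R) by apply/funext => x; rewrite mul0r.
by rewrite iotaR_scale ?scale0r //; exact: cts_cst.
Qed.
Lemma iotaR_sum I (r : seq I) (F : I -> X -> R) : (forall i, continuous (F i)) ->
  J (fun x => \sum_(i <- r) F i x) = \sum_(i <- r) J (F i).
Proof.
move=> cF; elim: r => [|i r IH].
  by rewrite big_nil -iotaR0; congr J; apply/funext => x; rewrite big_nil.
rewrite big_cons -IH -iotaR_add //; last exact: cts_sum.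
by congr J; apply/funext => x; rewrite big_cons.
Qed.

Lemma tr_iotaR_ge0 t f : tracial_states t -> continuous f ->
  (forall x, 0 <= f x) -> 0 <= tr t (J f).
Proof.
by move=> Tt cf f0; rewrite -iotaR_sqrt //; apply: tr_sqr_ge0 => //; exact: iotaR_star.
Qed.

Lemma tr_iotaR_le t f g : tracial_states t -> continuous f -> continuous g ->
  (forall x, f x <= g x) -> tr t (J f) <= tr t (J g).
Proof.
move=> Tt cf cg fg; rewrite -subr_ge0 -trB // -iotaR_sub //; apply: tr_iotaR_ge0 => //.
  exact: cts_sub.
by move=> x; rewrite subr_ge0.
Qed.
End RealPart.

(** * Layers of a positive function under real rank zero *)

Section Layers.
Variables (R : realType) (X : topologicalType) (A : cstarAlgType R) (iota : Cfun R X -> A).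
Hypothesis hom : Cfun_star_hom iota.
Variable S : set A.
Hypothesis RR0 : real_rank_le S 0.
Hypothesis iotaS : range iota `<=` S.
Local Notation J := (iotaR iota).

Lemma real_rank0_approx (g : A) (e : R) : S g -> star g = g -> 0 < e ->
  exists b c : A, [/\ star b = b, c * b = 1, b * c = 1 & cnorm (g - b) < e].
Proof.
move=> Sg sg e0; have [//|b [Sb [c _ [bc cb]] ne]] := @RR0 (fun=> g) _ _ (exprn_gt0 2 e0).
move: bc cb ne; rewrite !big_ord1 => bc cb.
have [_ sb] := Sb ord0; rewrite cnorm_sqr; last by rewrite starB sg sb.
rewrite ltr_pXn2r ?nnegrE ?cnorm_ge0 ?(ltW e0) // => ne.
(* c inverts b ^+ 2, hence commutes with b, so b * c inverts b *)
exists (b ord0), (b ord0 * c); split => //.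
- have h : c * b ord0 ^+ 2 = 1 by [].
  have bcb : b ord0 * c = c * b ord0.
    by rewrite -[LHS]mul1r -{1}h expr2 -!mulrA [X in c * (_ * X)]mulrA -expr2 bc mulr1.
  by rewrite bcb -mulrA -expr2.
- by rewrite mulrA -expr2.
Qed.

(** The hypotheses on [p1] and [p2] say that 1 - p1 lives where G <= -1/2, and p2
    where G >= 1/2.  A selfadjoint invertible close to G then has a positive
    spectral projection whose traces lie between those of p2 and p1, up to [d]. *)
Lemma cut_real (G p1 p2 : X -> R) (d : R) : 0 < d ->
  continuous G -> continuous p1 -> continuous p2 ->
  (forall x, 0 <= p1 x <= 1) -> (forall x, 0 <= p2 x <= 1) ->
  (forall x, (1 - p1 x) * (G x + 2^-1) <= 0) ->
  (forall x, 0 <= p2 x * (G x - 2^-1)) ->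
  exists p : A, [/\ star p = p, p ^+ 2 = p & forall t, tracial_states t ->
    tr t (J p2) - d <= tr t p /\ tr t p <= tr t (J p1) + d].
Proof.
move=> d0 cG c1 c2 b1 b2 G1 G2.
pose q1 := fun x => 1 - p1 x.
have cq1 : continuous q1 by apply: cts_sub => //; exact: cts_cst.
have q10 x : 0 <= q1 x by rewrite subr_ge0; case/andP: (b1 x).
have p20 x : 0 <= p2 x by case/andP: (b2 x).
pose n1 := cnorm (J q1); pose n2 := cnorm (J p2).
have n10 : 0 <= n1 by exact: cnorm_ge0.
have n20 : 0 <= n2 by exact: cnorm_ge0.
pose e := d / (2 * (n1 + n2 + 1)).
have den : 0 < 2 * (n1 + n2 + 1) by rewrite mulr_gt0 // ltr_wpDl // addr_ge0.
have e0 : 0 < e by rewrite divr_gt0.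
have ed : 2 * (e * (n1 + n2 + 1)) = d.
  by rewrite /e; field; rewrite gt_eqF // ltr_wpDl // addr_ge0.
have SG : S (J G) by apply: iotaS; exists (realC G).
have [b [c [sb cb bc gb]]] := real_rank0_approx SG (iotaR_star hom G) e0.
have [p [sp pp Hp]] := spectral_cut sb cb bc.
exists p; split => // t Tt.
have en1 : 2 * (cnorm (J G - b) * n1) <= d.
  rewrite -ed ler_pM2l // ler_pM ?cnorm_ge0 // ?(ltW gb) //; lra.
have en2 : 2 * (cnorm (J G - b) * n2) <= d.
  rewrite -ed ler_pM2l // ler_pM ?cnorm_ge0 // ?(ltW gb) //; lra.
have sq1p x : 0 <= 1 - p2 x by rewrite subr_ge0; case/andP: (b2 x).
have p10 x : 0 <= p1 x by case/andP: (b1 x).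
have pos (f : X -> R) : continuous f -> (forall x, 0 <= f x) ->
    0 <= tr t (p * J f) /\ 0 <= tr t ((1 - p) * J f).
  move=> cf f0; rewrite -(iotaR_sqrt hom cf f0); split;
    apply: tr_proj_sqr_ge0 => //; try exact: iotaR_star.
    by rewrite starB star1 sp.
  by rewrite expr2 mulrBl mul1r mulrBr mulr1 -expr2 pp subrr subr0.
have split1 (f : X -> R) : continuous f ->
    tr t p = tr t (p * J f) + tr t (p * J (fun x => 1 - f x)).
  move=> cf; rewrite -trD // -mulrDr -(iotaR_add hom) //; last first.
    by apply: cts_sub => //; exact: cts_cst.
  have -> : (fun x => f x + (1 - f x)) = (fun=> 1) by apply/funext => x; rewrite addrC subrK.
  by rewrite iotaR1 // mulr1.
have comp (f : X -> R) : tr t (p * J f) = tr t (J f) - tr t ((1 - p) * J f).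
  by rewrite mulrBl mul1r trB // opprB addrC subrK.
split.
- pose k (x : X) : R := p2 x * (G x - 2^-1).
  have ck : continuous k by rewrite /k; apply: cts_mul => //; apply: cts_sub => //; exact: cts_cst.
  have [_ H] := Hp t Tt (J G) (J (fun x => Num.sqrt (p2 x)))
    (J (fun x => Num.sqrt (k x))) (iotaR_star hom _) (iotaR_star hom _).
  rewrite !iotaR_sqrt // in H.
  have {}H := H _; have h2 : tr t ((1 - p) * J p2) <= d.
    apply: le_trans (H _) en2; rewrite -iotaR_mul // -iotaR_scale // -iotaR_sub //; last 2 first.
      exact: cts_mul.
      exact: cts_scale.
    by congr J; apply/funext => x; rewrite /k; ring.
  rewrite (split1 p2) // comp.
  have [+ _] := pos (fun x => 1 - p2 x) (cts_sub (@cts_cst _ _ 1) c2) sq1p.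
  by lra.
- pose k (x : X) : R := - ((1 - p1 x) * (G x + 2^-1)).
  have ck : continuous k.
    by move=> x; apply: cvgN; move: x; apply: cts_mul => //; apply: cts_add => //; exact: cts_cst.
  have k0 x : 0 <= k x by rewrite oppr_ge0.
  have [H _] := Hp t Tt (J G) (J (fun x => Num.sqrt (q1 x)))
    (J (fun x => Num.sqrt (k x))) (iotaR_star hom _) (iotaR_star hom _).
  rewrite !iotaR_sqrt // in H.
  have h2 : tr t (p * J q1) <= d.
    apply: le_trans (H _) en1; rewrite -iotaR_mul // -iotaR_scale //.
    rewrite -opprD -iotaR_add //; last 2 first.
      exact: cts_mul.
      exact: cts_scale.
    rewrite -scaleN1r -(rmorphN1 (@real_complex R)) -iotaR_scale //; last first.
      by apply: cts_add; [exact: cts_mul|exact: cts_scale].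
    by congr J; apply/funext => x; rewrite /k /q1; ring.
  rewrite (split1 p1) // comp.
  have [_ +] := pos p1 c1 p10.
  by move: h2; rewrite /q1; lra.
Qed.

Definition mx1_projection (p : A) (sp : star p = p) (pp : p ^+ 2 = p) : projection A.
Proof.
exists 1%N (\matrix_(i, j) p).
- by apply/matrixP => i j; rewrite !mxE.
- by apply/matrixP => i j; rewrite !mxE big_ord1 !mxE -expr2.
Defined.

Lemma trace_mx1_projection t p sp pp : trace_proj t (@mx1_projection p sp pp) = tr t p.
Proof. by rewrite /trace_proj big_ord1 mxE. Qed.

Lemma proj_sum n (p : 'I_n -> A) : (forall i, star (p i) = p i /\ p i ^+ 2 = p i) ->
  exists P : projection A, forall t, trace_proj t P = \sum_i tr t (p i).
Proof.
elim: n p => [|n IH] p Hp.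
  by exists (proj0 A) => t; rewrite /trace_proj !big_ord0.
have [P HP] := IH (fun i => p (widen_ord (leqnSn n) i)) (fun i => Hp _).
have [sp pp] := Hp ord_max.
exists (oplus P (mx1_projection sp pp)) => t.
by rewrite trace_proj_oplus HP trace_mx1_projection big_ord_recr.
Qed.

Lemma clamp_below (y : R) : (1 - clamp y) * (y - 1) <= 0.
Proof.
rewrite /clamp; case: (leP 0 y) => y0; [case: (leP 1 y)|case: (leP 1 0)] => y1; nra.
Qed.

Lemma clamp_above (y : R) : 0 <= clamp y * y.
Proof.
rewrite /clamp; case: (leP 0 y) => y0; [case: (leP 1 y)|case: (leP 1 0)] => y1; nra.
Qed.

Lemma clamp_sum (y : R) n : \sum_(i < n) clamp (y - i%:R) = Num.min (Num.max 0 y) n%:R.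
Proof.
elim: n => [|n IH]; first by rewrite big_ord0; case: (leP 0 y) => ?; case: leP => //; lra.
rewrite big_ord_recr /= IH /clamp.
have n0 : 0 <= n%:R :> R by []. rewrite -natr1.
by case: (leP 0 y) => ?; case: (leP 0 (y - n%:R)) => ?;
  case: leP => ?; case: leP => ?; case: leP => ?; lra.
Qed.

(** Sum of the projections cut at heights k + 3/2 for k < M.  Each lies between the
    layers k + 2 and k, so the sum misses at most two layers, each at most [chi],
    and the part of F above M. *)
Lemma layered_projection (F chi : X -> R) (e : R) :
  0 < e -> continuous F -> continuous chi ->
  (forall x, 0 <= F x) -> (forall x, chi x = 1 \/ (chi x = 0 /\ F x = 0)) ->
  exists P : projection A, forall t, tracial_states t ->
    tr t (J F) - 2 * tr t (J chi) - e <= trace_proj t P <= tr t (J F) + e.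
Proof.
move=> e0 cF cchi F0 Hchi.
pose nF := cnorm (J (fun x => F x ^+ 2)).
have nF0 : 0 <= nF by exact: cnorm_ge0.
have [M HM] : exists M : nat, nF / (2 * e) < M%:R.
  by exists (Num.bound (nF / (2 * e))); rewrite archi_boundP // divr_ge0 // mulr_ge0 // ltW.
have M0 : 0 < M%:R :> R by apply: le_lt_trans HM; rewrite divr_ge0 // mulr_ge0 // ltW.
pose d := e / (2 * M%:R).
have d0 : 0 < d by rewrite divr_gt0 // mulr_gt0.
have Md : M%:R * d = e / 2 by rewrite /d; field; rewrite gt_eqF.
have cl (c : R) : continuous (fun x => clamp (F x - c)).
  by apply: cts_clamp; apply: cts_sub => //; exact: cts_cst.
have H (i : 'I_M) : exists p : A, [/\ star p = p, p ^+ 2 = p & forall t, tracial_states t ->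
    tr t (J (fun x => clamp (F x - 2 - i%:R))) - d <= tr t p /\
    tr t p <= tr t (J (fun x => clamp (F x - i%:R))) + d].
  apply: (@cut_real (fun x => F x - i%:R - 3 / 2)) => //.
  - by apply: cts_sub; [apply: cts_sub => //; exact: cts_cst|exact: cts_cst].
  - by apply: cts_clamp; apply: cts_sub; [apply: cts_sub => //; exact: cts_cst|exact: cts_cst].
  - by move=> x; rewrite clamp_ge0 clamp_le1.
  - by move=> x; rewrite clamp_ge0 clamp_le1.
  - move=> x; have := clamp_below (F x - i%:R); congr (_ * _ <= _); lra.
  - move=> x; have := clamp_above (F x - 2 - i%:R); congr (_ <= _ * _); lra.
pose p i := projT1 (cid (H i)).
have Hp i : [/\ star (p i) = p i, p i ^+ 2 = p i & forall t, tracial_states t ->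
    tr t (J (fun x => clamp (F x - 2 - i%:R))) - d <= tr t (p i) /\
    tr t (p i) <= tr t (J (fun x => clamp (F x - i%:R))) + d] by exact: projT2 (cid (H i)).
have [P HP] := @proj_sum M p (fun i => let: And3 a b _ := Hp i in conj a b).
exists P => t Tt; rewrite HP.
have sum_cst : \sum_(i < M) d = e / 2.
  by rewrite sumr_const card_ord -Md mulr_natl.
have up : \sum_i tr t (p i) <= tr t (J F) + e / 2.
  apply: (@le_trans _ _ (\sum_(i < M) (tr t (J (fun x => clamp (F x - i%:R))) + d))).
    by apply: ler_sum => i _; have [_ _ /(_ t Tt)[]] := Hp i.
  rewrite big_split /= sum_cst lerD2r -tr_sum // -(iotaR_sum hom) //.
  apply: tr_iotaR_le => //; first exact: cts_sum.
  by move=> x; rewrite clamp_sum ge_min ge_max F0 lexx.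
have lo : tr t (J F) - 2 * tr t (J chi) -
    (4 * M%:R)^-1 * tr t (J (fun x => F x ^+ 2)) - e / 2 <= \sum_i tr t (p i).
  apply: (@le_trans _ _
    (\sum_(i < M) (tr t (J (fun x => clamp (F x - 2 - i%:R))) - d))); last first.
    by apply: ler_sum => i _; have [_ _ /(_ t Tt)[]] := Hp i.
  have cl2 i : continuous (fun x => clamp (F x - 2 - i)).
    by apply: cts_clamp; apply: cts_sub; [apply: cts_sub => //; exact: cts_cst|exact: cts_cst].
  rewrite sumrB sum_cst lerD2r -tr_sum // -(iotaR_sum hom) // -!trZ // -!trB //.
  rewrite -!iotaR_scale //; last exact: cts_sqr.
  rewrite -!iotaR_sub //; last 3 first.
    by apply: cts_sub => //; exact: cts_scale.
    by apply: cts_scale; exact: cts_sqr.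
    exact: cts_scale.
  apply: tr_iotaR_le => //.
  - apply: cts_sub; first by apply: cts_sub => //; exact: cts_scale.
    by apply: cts_scale; exact: cts_sqr.
  - exact: cts_sum.
  move=> x; rewrite clamp_sum.
  (* the part of F above M is at most F^2 / (4 M), as (F - 2 M)^2 >= 0; this controls
     it without a bound on F *)
  have : F x <= M%:R + (4 * M%:R)^-1 * F x ^+ 2.
    rewrite -subr_ge0.
    have -> : M%:R + (4 * M%:R)^-1 * F x ^+ 2 - F x = (4 * M%:R)^-1 * (F x - 2 * M%:R) ^+ 2.
      by field; rewrite gt_eqF.
    by rewrite mulr_ge0 ?sqr_ge0 // invr_ge0 mulr_ge0 // ltW.
  have : 0 <= (4 * M%:R)^-1 * F x ^+ 2 by rewrite mulr_ge0 ?sqr_ge0 // invr_ge0 mulr_ge0 // ltW.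
  have := F0 x; case: (Hchi x) => [->|[-> ->]].
    by case: (leP 0 (F x - 2)) => ?; [case: (leP (F x - 2) M%:R)|case: (leP 0 M%:R)] => ?; lra.
  by case: (leP 0 (0 - 2 : R)) => ?; [case: (leP (0 - 2) M%:R)|case: (leP 0 M%:R)] => ?; lra.
have tail : (4 * M%:R)^-1 * tr t (J (fun x => F x ^+ 2)) <= e / 2.
  rewrite ler_pdivrMl ?mulr_gt0 //.
  have := tr_norm_le Tt (J (fun x => F x ^+ 2)); rewrite ler_norml -/nF => /andP[_ h].
  move: HM; rewrite ltr_pdivrMr ?mulr_gt0 // => HM; nra.
by apply/andP; split; lra.
Qed.

End Layers.

(** * The minimal system on the Cantor space *)

(** The lists extending a given one generate a filter, along which the property
    of covering G can be checked near each point. *)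
Lemma compact_seq_cover (T : topologicalType) (I : eqType) (V : I -> set T) (G : set T) :
  compact G -> (forall i, open (V i)) -> (forall x, G x -> exists i, V i x) ->
  exists s : seq I, forall x, G x -> exists2 i, i \in s & V i x.
Proof.
move=> /compact_near_coveringP cG oV GV.
pose F : set_system (seq I) := [set P : set (seq I) |
  exists s0 : seq I, forall s : seq I, {subset s0 <= s} -> P s].
have FF : Filter F.
  split.
  - by exists [::].
  - move=> P Q [s HP] [s' HQ]; exists (s ++ s') => r sr; split.
      by apply: HP => i si; apply: sr; rewrite mem_cat si.
    by apply: HQ => i si; apply: sr; rewrite mem_cat si orbT.
  - by move=> P Q PQ [s HP]; exists s => r sr; apply: PQ; exact: HP.
have [|s Hs] := cG _ F (fun (s : seq I) x => exists2 i, i \in s & V i x) FF.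
  move=> x /GV[i Vix]; exists (V i, [set s : seq I | i \in s]) => /=.
    split; first exact: open_nbhs_nbhs.
    by exists [:: i] => s /(_ i (mem_head _ _)).
  by move=> [y s] [/= Viy si]; exists i.
by exists s => x Gx; exact: Hs.
Qed.

(** Reduces statements about the whole space to small clopen sets, without a choice
    of finite partition. *)
Lemma clopen_induction (T : topologicalType) (Q : set T -> Prop) :
  compact [set: T] -> Q set0 ->
  (forall V W, clopen V -> clopen W -> Q V -> Q W -> Q (V `|` W)) ->
  (forall x, exists V, [/\ clopen V, V x & Q V]) -> Q setT.
Proof.
move=> cT Q0 QU Qx.
pose Ix := {classic {V : set T | clopen V /\ Q V}}.
have [|x _|s Hs] := @compact_seq_cover T Ix (fun i => sval i) setT cT.
- by move=> i; case: (svalP i) => [[]].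
- by have [V [cV Vx QV]] := Qx x; exists (exist _ V (conj cV QV)).
have -> : [set: T] = \big[setU/set0]_(i <- s) sval i.
  by apply/seteqP; split => // x _; have [i si Vx] := Hs x I; rewrite -bigcup_seq; exists i.
suff : clopen (\big[setU/set0]_(i <- s) sval i) /\ Q (\big[setU/set0]_(i <- s) sval i) by case.
elim: s {Hs} => [|[W [cW QW]] r [cr Qr]]; first by rewrite big_nil; split => //; exact: clopen0.
by rewrite big_cons; split; [exact: clopenU|exact: QU].
Qed.

Lemma pair_cts (T U V : topologicalType) (f : T -> U) (g : T -> V) :
  continuous f -> continuous g -> continuous (fun x => (f x, g x)).
Proof. by move=> cf cg x; exact: (cvg_pair (cf x) (cg x)). Qed.

Section Fibre.
Variables (Omega : topologicalType) (w0 : Omega).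
Hypothesis Omega_connected : connected [set: Omega].
Local Notation K := cantor_space.
Local Notation X := (K * Omega)%type.

Definition base_map (a : X -> X) (k : K) : K := (a (k, w0)).1.

Lemma slice_cts (T : topologicalType) (a : X -> T) k :
  continuous a -> continuous (fun w => a (k, w)).
Proof.
move=> ca w; apply: (@continuous_comp _ _ _ (fun w => (k, w)) a); last exact: ca.
by apply: pair_cts => ?; [exact: cvg_cst|exact: cvg_id].
Qed.

Lemma fst_cts (a : X -> X) : continuous a -> continuous (fun x => (a x).1).
Proof. by move=> ca x; apply: (@continuous_comp _ _ _ a fst); [exact: ca|exact: cvg_fst]. Qed.

Lemma base_map_cts a : continuous a -> continuous (base_map a).
Proof.
move=> ca k; apply: (@continuous_comp _ _ _ (fun k => (k, w0)) (fun x => (a x).1));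
  last exact: fst_cts.
by apply: pair_cts => ?; [exact: cvg_id|exact: cvg_cst].
Qed.

(** A connected fibre has a connected, hence constant, image in a zero-dimensional
    base. *)
Lemma base_mapE a x : continuous a -> (a x).1 = base_map a x.1.
Proof.
move=> ca; case: x => k w /=; apply/eqP/negP => /negP ne.
have [U [cU Uw Uw0]] := cantor_zero_dimensional ne.
pose h w := (a (k, w)).1.
have ch : continuous h by apply: (@slice_cts _ (fun x => (a x).1)); exact: fst_cts.
have [oh clh] := preimage_clopen cU ch.
have : h @^-1` U = setT.
  apply: Omega_connected; first by exists w.
    by exists (h @^-1` U) => //; rewrite setTI.
  by exists (h @^-1` U) => //; rewrite setTI.
by move=> /seteqP[_ /(_ w0 I)].
Qed.

Variable alpha : homeomorphism X.
Hypothesis alpha_minimal : minimal alpha.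
Let a0 := base_map alpha.
Let b0 := base_map (homeo_inv alpha).

Lemma base_mapK : cancel a0 b0.
Proof.
move=> k; rewrite /a0 /b0; have := base_mapE (alpha (k, w0)) (@homeo_inv_cts _ alpha).
by rewrite homeo_funK.
Qed.

Lemma base_invK : cancel b0 a0.
Proof.
move=> k; rewrite /a0 /b0; have := base_mapE (homeo_inv alpha (k, w0)) (@homeo_fun_cts _ alpha).
by rewrite homeo_invK.
Qed.

Lemma minimal_base (F : set K) : closed F -> (forall k, F k -> F (a0 k)) ->
  (forall k, F k -> F (b0 k)) -> F = set0 \/ F = setT.
Proof.
move=> cF Fa Fb.
have [||E|E] := alpha_minimal (F := fst @^-1` F).
- by apply: preimage_closed => // x _; exact: cvg_fst.
- apply/seteqP; split => [_ [x Fx <-]|x Fx] /=.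
    by rewrite base_mapE; [exact: Fa|exact: homeo_fun_cts].
  exists (homeo_inv alpha x); last exact: homeo_invK.
  by rewrite /= base_mapE; [exact: Fb|exact: homeo_inv_cts].
- by left; apply/seteqP; split => // k Fk; have : (fst @^-1` F) (k, w0) by []; rewrite E.
- by right; apply/seteqP; split => // k _; have : (fst @^-1` F) (k, w0) by rewrite E.
Qed.

(** A periodic orbit would be a finite, hence closed, invariant set. *)
Lemma base_aperiodic n k : iter n.+1 a0 k <> k.
Proof.
move=> Ek; pose F := [set k' | exists i, k' = iter i a0 k].
have finF : finite_set F.
  apply: (@sub_finite_set _ _ ((fun i => iter i a0 k) @` `I_n.+1)); last exact: finite_image.
  move=> _ [i ->]; exists (i %% n.+1)%N; first by rewrite /= ltn_mod.
  have Ej j : iter (j * n.+1) a0 k = k.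
    by elim: j => // j IH; rewrite mulSn iterD IH Ek.
  by rewrite /= {2}(divn_eq i n.+1) addnC iterD Ej.
have clF : closed F.
  apply/accessible_finite_set_closed: F finF; apply: hausdorff_accessible.
  exact: cantor_space_hausdorff.
have [|_ [i ->]||] := minimal_base clF.
- by move=> _ [i ->]; exists i.+1.
- case: i => [|i]; last by exists i; rewrite iterS base_mapK.
  by exists n; rewrite /= -{1}Ek iterS base_mapK.
- by move=> /seteqP[/(_ k) + _] => /(_ (ex_intro _ 0%N erefl)).
(* the orbit is countable, hence misses the diagonal sequence *)
pose diag : K := fun j => ~~ (iter j a0 k : nat -> bool) j.
move=> /seteqP[_ /(_ diag I)[i /(congr1 (fun c : nat -> bool => c i))]].
by rewrite /diag; case: (iter i a0 k i).
Qed.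

Lemma base_inv_aperiodic n k : iter n.+1 b0 k <> k.
Proof.
move=> E; apply: (@base_aperiodic n k); rewrite -{1}E.
elim: (n.+1) k {E} => // m IH k; by rewrite iterSr iterS base_invK.
Qed.

Lemma base_cts : continuous a0. Proof. exact/base_map_cts/homeo_fun_cts. Qed.
Lemma base_inv_cts : continuous b0. Proof. exact/base_map_cts/homeo_inv_cts. Qed.

Lemma iter_cts (T : topologicalType) (f : T -> T) n : continuous f -> continuous (iter n f).
Proof.
move=> cf; elim: n => [|n IH] x; first exact: cvg_id.
by apply: (@continuous_comp _ _ _ (iter n f) f); [exact: IH|exact: cf].
Qed.

Lemma displaced_clopen (d : K -> K) k : continuous d -> d k <> k ->
  exists V, [/\ clopen V, V k & forall k', V k' -> ~ V (d k')].
Proof.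
move=> cd /eqP; rewrite eq_sym => /cantor_zero_dimensional[U [cU Uk Udk]].
exists (U `&` ~` (d @^-1` U)); split => //.
  by apply: clopenI => //; apply: clopenC => //; exact: preimage_clopen.
by move=> k' [Uk' nUk'] [Udk' _].
Qed.

Lemma wandering_clopen (k : K) N : exists V, [/\ clopen V, V k &
  forall k' d, (d < N)%N -> V k' -> ~ V (iter d.+1 a0 k')].
Proof.
elim: N => [|N [V [cV Vk HV]]]; first by exists setT; split => //; exact: clopenT.
have [W [cW Wk HW]] := displaced_clopen (@iter_cts _ _ N.+1 base_cts) (@base_aperiodic N k).
exists (V `&` W); split => //; first exact: clopenI.
move=> k' d; rewrite ltnS leq_eqVlt => /orP[/eqP-> [_ /HW] + [_]//|dN [Vk' _] [Vd _]].
exact: HV Vk' Vd.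
Qed.

(** The points whose two-sided orbit avoids U form a closed invariant set. *)
Lemma clopen_sweeps (U : set K) : open U -> U !=set0 -> forall k,
  exists n, U (iter n a0 k) \/ U (iter n b0 k).
Proof.
move=> oU [k0 Uk0] k.
pose F := [set k | forall n, ~ U (iter n a0 k) /\ ~ U (iter n b0 k)].
have clF : closed F.
  have -> : F = \bigcap_n (~` ((iter n a0) @^-1` U) `&` ~` ((iter n b0) @^-1` U)).
    by apply/seteqP; split => [c Fc n _|c Fc n]; [exact: Fc|exact: Fc].
  apply: closed_bigI => n _; apply: closedI; apply: open_closedC; apply: open_comp => // x _;
    apply: iter_cts; [exact: base_cts|exact: base_inv_cts].
have [||F0|FT] := minimal_base clF.
- move=> c Fc n; split; first by rewrite -iterSr; exact: (Fc n.+1).1.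
  case: n => [|n]; first exact: (Fc 1%N).1.
  by rewrite iterSr base_mapK; exact: (Fc n).2.
- move=> c Fc n; split; last by rewrite -iterSr; exact: (Fc n.+1).2.
  case: n => [|n]; first exact: (Fc 1%N).2.
  by rewrite iterSr base_invK; exact: (Fc n).1.
- apply: contrapT => H; have : F k.
    by move=> n; split => Un; apply: H; exists n; [left|right].
  by rewrite F0.
- have Fk0 : F k0 by rewrite FT.
  by case: (Fk0 0%N).
Qed.

End Fibre.

(** * Concentrating traces over a small clopen set *)

Section CrossedProduct.
Variables (R : realType) (Omega : topologicalType) (w0 : Omega).
Hypothesis Omega_connected : connected [set: Omega].
Local Notation K := cantor_space.
Local Notation X := (K * Omega)%type.
Variable alpha : homeomorphism X.
Hypothesis alpha_minimal : minimal alpha.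
Variables (A : cstarAlgType R) (iota : Cfun R X -> A) (u : A).
Hypothesis cov : covariant alpha iota u.
Local Notation J := (iotaR iota).
Local Notation a0 := (base_map w0 alpha).
Local Notation b0 := (base_map w0 (homeo_inv alpha)).
Implicit Types (f g F : X -> R) (t : {ptws A -> R[i]^o}).

Lemma cov_hom : Cfun_star_hom iota. Proof. by case: cov. Qed.
Lemma cov_unitary : unitary u. Proof. by case: cov. Qed.
Local Notation hom := cov_hom.

Lemma cts_comp f (a : X -> X) : continuous f -> continuous a -> continuous (f \o a).
Proof. by move=> cf ca x; apply: continuous_comp; [exact: ca|exact: cf]. Qed.

Lemma iotaR_conj f : continuous f -> u * J f * star u = J (f \o homeo_inv alpha).
Proof.
move=> cf; case: cov => _ _ ->; congr iota; apply: Cfun_eqP => x.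
rewrite realCE; last by apply: cts_comp => //; exact: homeo_inv_cts.
exact: (realCE _ cf).
Qed.

Lemma u_iotaR f : continuous f -> u * J f = J (f \o homeo_inv alpha) * u.
Proof. by move=> cf; rewrite -iotaR_conj // -mulrA (proj1 cov_unitary) mulr1. Qed.

Lemma ustar_iotaR f : continuous f -> star u * J f = J (f \o alpha) * star u.
Proof.
move=> cf; have cfa : continuous (f \o alpha) by apply: cts_comp => //; exact: homeo_fun_cts.
have -> : J f = u * J (f \o alpha) * star u.
  by rewrite iotaR_conj //; congr J; apply/funext => x /=; rewrite homeo_invK.
by rewrite !mulrA (proj1 cov_unitary) mul1r.
Qed.

(** Traces restrict to alpha-invariant functionals on C(X). *)
Lemma tr_iotaR_inv t f : tracial_states t -> continuous f ->
  tr t (J (f \o homeo_inv alpha)) = tr t (J f).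
Proof. by move=> Tt cf; rewrite -iotaR_conj // trC // mulrA (proj1 cov_unitary) mul1r. Qed.

Lemma tr_iotaR_fun t f : tracial_states t -> continuous f ->
  tr t (J (f \o alpha)) = tr t (J f).
Proof.
move=> Tt cf; rewrite -tr_iotaR_inv //; last by apply: cts_comp => //; exact: homeo_fun_cts.
by congr (tr _ (J _)); apply/funext => x /=; rewrite homeo_invK.
Qed.

Lemma iter_fst (a : X -> X) n x : continuous a ->
  (iter n a x).1 = iter n (base_map w0 a) x.1.
Proof. by move=> ca; elim: n => //= n <-; rewrite (base_mapE w0 Omega_connected). Qed.

Lemma tr_iotaR_iter_inv t f n : tracial_states t -> continuous f ->
  tr t (J (f \o iter n (homeo_inv alpha))) = tr t (J f).
Proof.
move=> Tt cf; elim: n => [//|n <-]; rewrite -[RHS]tr_iotaR_inv //.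
  by congr (tr _ (J _)); apply/funext => x; rewrite /= -iterSr.
by apply: cts_comp => //; apply: iter_cts; exact: homeo_inv_cts.
Qed.

Lemma tr_iotaR_iter t f n : tracial_states t -> continuous f ->
  tr t (J (f \o iter n alpha)) = tr t (J f).
Proof.
move=> Tt cf; elim: n => [//|n <-]; rewrite -[RHS]tr_iotaR_fun //.
  by congr (tr _ (J _)); apply/funext => x; rewrite /= -iterSr.
by apply: cts_comp => //; apply: iter_cts; exact: homeo_fun_cts.
Qed.

Definition indic_base (V : set K) (x : X) : R := (x.1 \in V)%:R.

Lemma indic_base_cts V : clopen V -> continuous (indic_base V).
Proof.
move=> cV x; have [oF cF] : clopen (fst @^-1` V : set X).
  by apply: preimage_clopen => // y; exact: cvg_fst.
rewrite /indic_base; apply: cvg_near_cst; have [Vx|Vx] := pselect (V x.1).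
  by apply: filterS (open_nbhs_nbhs (conj oF Vx)) => y Vy; rewrite !mem_set.
have oC : open (~` (fst @^-1` V : set X)) by exact: closed_openC.
by apply: filterS (open_nbhs_nbhs (conj oC Vx)) => y Vy; rewrite !memNset.
Qed.

Lemma indic_base_ge0 V x : 0 <= indic_base V x. Proof. exact: ler0n. Qed.
Lemma indic_baseT : indic_base setT = fun=> 1.
Proof. by apply/funext => x; rewrite /indic_base mem_set. Qed.
Lemma indic_base0 x : indic_base set0 x = 0.
Proof. by rewrite /indic_base memNset. Qed.
Lemma indic_baseU V W x :
  indic_base (V `|` W) x = indic_base V x + (1 - indic_base V x) * indic_base W x.
Proof. by rewrite /indic_base in_setU; case: (x.1 \in V); rewrite /= ?mulr1n ?mulr0n; ring. Qed.

(** Locally on the base, a power of alpha or of its inverse carries the fibres into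
    those over U, and traces do not see this displacement. *)
Lemma sweep (U : set K) : clopen U -> U !=set0 ->
  forall f, continuous f -> (forall x, 0 <= f x) ->
  exists F, [/\ continuous F, forall x, 0 <= F x, forall x, ~ U x.1 -> F x = 0 &
    forall t, tracial_states t -> tr t (J F) = tr t (J f)].
Proof.
move=> cU U0.
pose Q V := clopen V /\ forall f, continuous f -> (forall x, 0 <= f x) ->
  exists F, [/\ continuous F, forall x, 0 <= F x, forall x, ~ U x.1 -> F x = 0 &
    forall t, tracial_states t -> tr t (J F) = tr t (J (fun x => indic_base V x * f x))].
suff [_ QT] : Q setT.
  move=> f cf f0; have [F [cF F0 FU FT]] := QT f cf f0; exists F; split => // t Tt.
  by rewrite FT //; congr (tr _ (J _)); apply/funext => x; rewrite indic_baseT mul1r.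
apply: clopen_induction; first exact: cantor_space_compact.
- split; first exact: clopen0.
  move=> f _ _; exists (fun=> 0); split => //; first exact: cts_cst.
  by move=> t _; congr (tr _ (J _)); apply/funext => x; rewrite indic_base0 mul0r.
- move=> V W cV cW [_ QV] [_ QW]; split; first exact: clopenU.
  move=> f cf f0; have [F [cF F0 FU FT]] := QV f cf f0.
  have cg : continuous (fun x => (1 - indic_base V x) * f x).
    by apply: cts_mul => //; apply: cts_sub; [exact: cts_cst|exact: indic_base_cts].
  have [|G [cG G0 GU GT]] := QW _ cg.
    by move=> x; rewrite mulr_ge0 // subr_ge0 /indic_base lern1; case: (_ \in _).
  exists (fun x => F x + G x); split; first exact: cts_add.
  + by move=> x; rewrite addr_ge0.
  + by move=> x Ux; rewrite FU // GU // addr0.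
  + move=> t Tt; rewrite (iotaR_add hom) // trD // FT // GT // -trD // -(iotaR_add hom).
    * by congr (tr _ (J _)); apply/funext => x; rewrite indic_baseU; ring.
    * by apply: cts_mul => //; exact: indic_base_cts.
    * by apply: cts_mul => //; exact: indic_base_cts.
- move=> k; have [n Un] := clopen_sweeps w0 Omega_connected alpha_minimal (proj1 cU) U0 k.
  have main (a b : X -> X) : continuous a -> continuous b -> cancel a b -> cancel b a ->
      (forall t f, tracial_states t -> continuous f -> tr t (J (f \o iter n b)) = tr t (J f)) ->
      U (iter n (base_map w0 a) k) -> exists V, [/\ clopen V, V k & Q V].
    move=> ca cb ab ba ht Uk; exists (iter n (base_map w0 a) @^-1` U).
    have cV : clopen (iter n (base_map w0 a) @^-1` U).
      by apply: preimage_clopen => //; apply: iter_cts; exact: base_map_cts.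
    split => //; split => // f cf f0.
    have cVf : continuous (fun x => indic_base (iter n (base_map w0 a) @^-1` U) x * f x).
      by apply: cts_mul => //; exact: indic_base_cts.
    exists ((fun x => indic_base (iter n (base_map w0 a) @^-1` U) x * f x) \o iter n b); split.
    + by apply: cts_comp => //; exact: iter_cts.
    + by move=> x; rewrite /= mulr_ge0 // indic_base_ge0.
    + move=> x Ux; rewrite /= /indic_base memNset ?mul0r //= -iter_fst //.
      suff -> : iter n a (iter n b x) = x by [].
      by elim: (n) x {Ux} => // m IH x; rewrite iterS iterSr IH ba.
    + by move=> t Tt; rewrite ht.
  have [fK iK] := (@homeo_funK _ alpha, @homeo_invK _ alpha).
  have [cf ci] := (@homeo_fun_cts _ alpha, @homeo_inv_cts _ alpha).
  by case: Un => Un; [apply: (main alpha (homeo_inv alpha)) => // t f Tt c; exact: tr_iotaR_iter_inv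
    |apply: (main (homeo_inv alpha) alpha) => // t f Tt c; exact: tr_iotaR_iter].
Qed.

(** N disjoint translates of U have equal measure. *)
Lemma small_clopen N : (0 < N)%N -> exists U : set K, [/\ clopen U, U !=set0 &
  forall t, tracial_states t -> N%:R * tr t (J (indic_base U)) <= 1].
Proof.
move=> N0; pose k0 : K := fun=> true.
have [U [cU Uk HU]] := wandering_clopen w0 Omega_connected alpha_minimal (k0 : K) N.
exists U; split => //; first by exists k0.
move=> t Tt; have -> : N%:R * tr t (J (indic_base U)) =
    \sum_(i < N) tr t (J (indic_base U \o iter i (homeo_inv alpha))).
  rewrite (eq_bigr (fun=> tr t (J (indic_base U)))); last first.
    by move=> i _; apply: tr_iotaR_iter_inv => //; exact: indic_base_cts.
  by rewrite sumr_const card_ord mulr_natl.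
have cc i : continuous (indic_base U \o iter i (homeo_inv alpha)).
  by apply: cts_comp; [exact: indic_base_cts|apply: iter_cts; exact: homeo_inv_cts].
rewrite -tr_sum // -(iotaR_sum hom) //.
rewrite -(tr1 Tt) -(iotaR1 hom); apply: tr_iotaR_le => //; first exact: hom.
- exact: cts_sum.
- exact: cts_cst.
move=> x.
have Hd i j : (i < j < N)%N -> U (iter i b0 x.1) -> U (iter j b0 x.1) -> False.
  move=> /andP[ij jN] Ui Uj; have [d Ed] : exists d, j = (d.+1 + i)%N.
    by exists (j - i).-1; rewrite prednK ?subn_gt0 // subnK // ltnW.
  apply: (HU (iter j b0 x.1) d) => //.
    by rewrite (leq_ltn_trans _ jN) // Ed addSn leqW // leq_addr.
  suff -> : iter d.+1 a0 (iter j b0 x.1) = iter i b0 x.1 by [].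
  rewrite Ed iterD; elim: (d.+1) (iter i b0 x.1) => // m IH y.
  by rewrite iterSr iterS (base_invK w0 Omega_connected) IH.
have [[i iN Ui]|no] := pselect (exists2 i, (i < N)%N & U (iter i b0 x.1)); last first.
  rewrite big1 // => i _; rewrite /= /indic_base memNset // iter_fst; last exact: homeo_inv_cts.
  by move=> Ui; apply: no; exists i.
rewrite (bigD1 (Ordinal iN)) //= big1 ?addr0; first by rewrite /indic_base lern1; case: (_ \in _).
move=> j ji; rewrite /= /indic_base memNset // iter_fst; last exact: homeo_inv_cts.
move=> Uj; have [ij|ji'|ij] := ltngtP i j.
- by apply: (Hd i j) => //; rewrite ij ltn_ord.
- by apply: (Hd j i) => //; rewrite ji'.
- by move/eqP: ji; apply; exact: val_inj.
Qed.

(** Concentrating f over U makes the rounding error of the layers at most twice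
    the measure of U. *)
Lemma positive_approx (S : set A) f (e : R) : real_rank_le S 0 -> range iota `<=` S ->
  continuous f -> (forall x, 0 <= f x) -> 0 < e ->
  exists P : projection A, forall t, tracial_states t -> `|trace_proj t P - tr t (J f)| <= e.
Proof.
move=> RR0 iS cf f0 e0.
have [N HN] : exists N : nat, 4 / e < N%:R.
  by exists (Num.bound (4 / e)); rewrite archi_boundP // divr_ge0 // ltW.
have N0 : (0 < N)%N by rewrite -(ltr_nat R) (lt_trans _ HN) // divr_gt0.
have [U [cU Une HU]] := small_clopen N0.
have [F [cF F0 FU FT]] := sweep cU Une cf f0.
have [|||P HP] := @layered_projection _ _ _ _ hom S RR0 iS F (indic_base U) (e / 2) _ cF _ F0.
- exact: divr_gt0.
- exact: indic_base_cts.
- move=> x; have [Ux|Ux] := pselect (U x.1); first by left; rewrite /indic_base mem_set.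
  by right; rewrite /indic_base memNset // FU.
exists P => t Tt; have := HP t Tt; rewrite FT // => /andP[lo hi].
have := HU t Tt; set c := tr t (J (indic_base U)) in lo * => Nc.
have c0 : 0 <= c by apply: tr_iotaR_ge0 => //; [exact: hom|exact: indic_base_cts].
have : 4 * c <= e.
  move: HN; rewrite ltr_pdivrMr // => HN; nra.
by rewrite ler_norml; lra.
Qed.

End CrossedProduct.

(** * Traces are determined by C(X) *)

Section Closure.
Variables (R : realType) (A : cstarAlgType R).

Definition norm_closure (W : set A) : set A :=
  [set a | forall e : R, 0 < e -> exists2 b, W b & cnorm (a - b) < e].

Lemma norm_closure_subalgebra (W : set A) :
  (forall c : R[i], W (c *: 1)) -> (forall a b, W a -> W b -> W (a + b)) ->
  (forall a b, W a -> W b -> W (a * b)) -> (forall a, W a -> W (star a)) ->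
  cstar_subalgebra (norm_closure W).
Proof.
move=> W1 WD WM Ws.
have sub a : W a -> norm_closure W a by move=> Wa e e0; exists a => //; rewrite subrr cnorm0.
have cM a b : norm_closure W a -> norm_closure W b -> norm_closure W (a * b).
  move=> Wa Wb e e0; have e2 : 0 < e / 2 by rewrite divr_gt0.
  have b0 : 0 < cnorm b + 1 by rewrite ltr_wpDl // cnorm_ge0.
  have [a' Wa' na] := Wa (e / 2 / (cnorm b + 1)) (divr_gt0 e2 b0).
  have a0 : 0 < cnorm a' + 1 by rewrite ltr_wpDl // cnorm_ge0.
  have [b' Wb' nb] := Wb (e / 2 / (cnorm a' + 1)) (divr_gt0 e2 a0).
  exists (a' * b'); first exact: WM.
  have -> : a * b - a' * b' = (a - a') * b + a' * (b - b').
    by rewrite mulrBl mulrBr addrA subrK.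
  rewrite (le_lt_trans (cnormD _ _)) // [ltRHS]splitr ltr_leD //.
    rewrite (le_lt_trans (cnormM _ _)) // (le_lt_trans (y := cnorm (a - a') * (cnorm b + 1))) //.
      by rewrite ler_wpM2l ?cnorm_ge0 // lerDl.
    by rewrite -ltr_pdivlMr.
  rewrite (le_trans (cnormM _ _)) // (le_trans (y := (cnorm a' + 1) * cnorm (b - b'))) //.
    by rewrite ler_wpM2r ?cnorm_ge0 // lerDl.
  by rewrite mulrC -ler_pdivlMr // ltW.
split => //.
- by apply: sub; rewrite -(scale1r 1).
- move=> c a b Wa Wb e e0; have e2 : 0 < e / 2 by rewrite divr_gt0.
  have : norm_closure W (c *: a) by rewrite -mulr_algl; apply: cM => //; exact: sub.
  move=> /(_ _ e2)[x Wx nx]; have [y Wy ny] := Wb _ e2; exists (x + y); first exact: WD.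
  rewrite opprD addrACA (le_lt_trans (cnormD _ _)) // [ltRHS]splitr ltrD //.
- move=> a Wa e e0; have [b Wb nb] := Wa _ e0; exists (star b); first exact: Ws.
  by rewrite -starB cnorm_starE.
- move=> a Wa e e0; have e2 : 0 < e / 2 by rewrite divr_gt0.
  have [b Wb nb] := Wa _ e2; have [c Wc nc] := Wb _ e2; exists c => //.
  by rewrite -(subrKA b) (le_lt_trans (cnormD _ _)) // [ltRHS]splitr ltrD.
Qed.
End Closure.

Section Uniqueness.
Variables (R : realType) (Omega : topologicalType) (w0 : Omega).
Hypothesis Omega_connected : connected [set: Omega].
Local Notation K := cantor_space.
Local Notation X := (K * Omega)%type.
Variable alpha : homeomorphism X.
Hypothesis alpha_minimal : minimal alpha.
Variables (A : cstarAlgType R) (iota : Cfun R X -> A) (u : A).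
Hypothesis cov : covariant alpha iota u.
Hypothesis gen : cstar_generated (range iota `|` [set u]) = setT.
Local Notation J := (iotaR iota).
Local Notation chi := (@indic_base R Omega).
Local Notation hom := (cov_hom cov).
Implicit Types (f g : Cfun R X) (t : {ptws A -> R[i]^o}).

Lemma iotaR_comm f (h : X -> R) : iota f * J h = J h * iota f.
Proof.
rewrite /iotaR -!(iota_mul hom); congr iota; apply: Cfun_eqP => x; exact: mulrC.
Qed.

(** If V is disjoint from its image under the n-th shift, then
    t(g 1_V v^n) = t(g 1_V v^n 1_V) = 0, and such V cover the base. *)
Lemma trace_shift0 (v : A) (d : X -> X) : continuous d ->
  (forall h, continuous h -> v * J h = J (h \o d) * v) ->
  (forall n k, iter n.+1 (base_map w0 d) k <> k) ->
  forall t n g, tracial_states t -> tr t (iota g * v ^+ n.+1) = 0.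
Proof.
move=> cd vJ ap t n g Tt.
have vnJ m h : continuous h -> v ^+ m * J h = J (h \o iter m d) * v ^+ m.
  move=> ch; elim: m => [|m IH]; first by rewrite !expr0 mul1r mulr1.
  rewrite exprS -mulrA IH mulrA vJ; last by apply: cts_comp => //; exact: iter_cts.
  rewrite -mulrA -exprS; congr (J _ * _); apply/funext => x /=; by rewrite -iterSr.
pose Q V := forall g, tr t (iota g * J (chi V) * v ^+ n.+1) = 0.
suff QT : Q setT by have := QT g; rewrite indic_baseT (iotaR1 hom) mulr1.
apply: clopen_induction; first exact: cantor_space_compact.
- move=> {}g; have -> : chi set0 = (fun=> 0) :> (X -> R) by apply/funext => x; rewrite indic_base0.
  by rewrite (iotaR0 hom) mulr0 mul0r tr0.
- move=> V W cV cW QV QW {}g.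
  have -> : chi (V `|` W) = (fun x => chi V x + (1 - chi V x) * chi W x) :> (X -> R).
    by apply/funext => x; rewrite indic_baseU.
  have cVc : continuous (fun x : X => 1 - chi V x : R).
    by apply: cts_sub; [exact: cts_cst|exact: indic_base_cts].
  rewrite (iotaR_add hom); [|exact: indic_base_cts|by apply: cts_mul => //; exact: indic_base_cts].
  rewrite (iotaR_mul hom) //; last exact: indic_base_cts.
  rewrite mulrDr mulrDl trD // QV add0r mulrA {1}/iotaR -(iota_mul hom); exact: QW.
- move=> k; have [V [cV Vk HV]] :=
    displaced_clopen (@iter_cts _ _ n.+1 (@base_map_cts _ w0 _ cd)) (ap n k).
  exists V; split => // {}g.
  have cchi : continuous (chi V) by exact: indic_base_cts.
  have cc : continuous (chi V \o iter n.+1 d) by apply: cts_comp => //; exact: iter_cts.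
  have -> : J (chi V) = J (chi V) * J (chi V).
    rewrite -(iotaR_mul hom) //; congr J; apply/funext => x; rewrite /indic_base; case: (_ \in _).
      by rewrite mulr1.
    by rewrite mulr0.
  rewrite mulrA iotaR_comm -!mulrA trC // -!mulrA vnJ // (mulrA (J _)) -(iotaR_mul hom) //.
  have -> : (fun x => chi V x * (chi V \o iter n.+1 d) x) = (fun=> 0) :> (X -> R).
    apply/funext => x; rewrite /= /indic_base -[d _]/(iter n.+1 d x) (iter_fst w0) //.
    have [/HV Vx|Vx] := pselect (V x.1); first by rewrite (memNset Vx) mulr0.
    by rewrite memNset // mul0r.
  by rewrite (iotaR0 hom) mul0r mulr0 tr0.
Qed.

(** All the monomials with m <> n have trace 0. *)
Lemma trace_monomial s t : tracial_states s -> tracial_states t ->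
  (forall f, tr s (iota f) = tr t (iota f)) ->
  forall f m n, tr s (iota f * u ^+ m * star u ^+ n) = tr t (iota f * u ^+ m * star u ^+ n).
Proof.
move=> Ts Tt st f m n; have [su us] := cov_unitary cov.
have cu : GRing.comm u (star u) by rewrite /GRing.comm su us.
have uX k : u ^+ k * star u ^+ k = 1 by rewrite -exprMn_comm // us expr1n.
have Hu r k g : tracial_states r -> tr r (iota g * u ^+ k.+1) = 0.
  apply: (@trace_shift0 u (homeo_inv alpha)); first exact: homeo_inv_cts.
    by move=> h ch; apply: u_iotaR.
  exact: base_inv_aperiodic.
have Hs r k g : tracial_states r -> tr r (iota g * star u ^+ k.+1) = 0.
  apply: (@trace_shift0 (star u) alpha); first exact: homeo_fun_cts.
    by move=> h ch; apply: ustar_iotaR.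
  exact: base_aperiodic.
rewrite -mulrA; have [mn|nm|->] := ltngtP m n.
- have -> : n = (m + (n - m).-1.+1)%N by rewrite prednK ?subn_gt0 // subnKC // ltnW.
  by rewrite exprD (mulrA (u ^+ m)) uX mul1r !Hs.
- have -> : m = ((m - n).-1.+1 + n)%N by rewrite prednK ?subn_gt0 // subnK // ltnW.
  by rewrite exprD -mulrA uX mulr1 !Hu.
- by rewrite uX mulr1.
Qed.

(** The *-algebra generated by C(X) and [u].  Using powers of [u] and of its adjoint
    together avoids integer exponents. *)
Inductive words : A -> Prop :=
| words0 : words 0
| wordsD f m n a : words a -> words (iota f * u ^+ m * star u ^+ n + a).

Lemma words_mono f m n : words (iota f * u ^+ m * star u ^+ n).
Proof. by rewrite -[X in words X]addr0; apply: wordsD; exact: words0. Qed.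

Lemma words_add a b : words a -> words b -> words (a + b).
Proof.
move=> Wa Wb; elim: Wa => [|f m n {}a _ IH]; first by rewrite add0r.
by rewrite -addrA; exact: wordsD.
Qed.

Lemma u_iota f : u * iota f = iota (Cfun_inv alpha f) * u.
Proof. by case: cov => _ [su _] <-; rewrite -mulrA su mulr1. Qed.

Lemma ustar_iota f : exists g, star u * iota f = iota g * star u.
Proof.
exists (mkC (@Cfun_comp_cts _ _ f _ (@homeo_fun_cts _ alpha))).
set g := mkC _; case: cov => _ [su us] h.
have -> : iota f = u * iota g * star u.
  rewrite h; congr iota; apply: Cfun_eqP => x.
  by rewrite -[RHS]/(Cval f (alpha (homeo_inv alpha x))) homeo_invK.
by rewrite !mulrA su mul1r.
Qed.

Lemma monomial_iota m n f : exists g,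
  u ^+ m * star u ^+ n * iota f = iota g * (u ^+ m * star u ^+ n).
Proof.
have [g Hg] : exists g, star u ^+ n * iota f = iota g * star u ^+ n.
  elim: n => [|n [g IH]]; first by exists f; rewrite expr0 mul1r mulr1.
  have [g' Hg'] := ustar_iota g; exists g'.
  by rewrite exprS -mulrA IH mulrA Hg' -mulrA.
have [g' Hg'] : exists g', u ^+ m * iota g = iota g' * u ^+ m.
  elim: m => [|m [g' IH]]; first by exists g; rewrite expr0 mul1r mulr1.
  exists (Cfun_inv alpha g').
  by rewrite exprS -mulrA IH mulrA u_iota -mulrA.
by exists g'; rewrite -mulrA Hg !mulrA Hg'.
Qed.

Lemma words_mul a b : words a -> words b -> words (a * b).
Proof.
have [su us] := cov_unitary cov.
have cu : GRing.comm u (star u) by rewrite /GRing.comm su us.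
move=> Wa Wb; elim: Wa => [|f m n {}a _ IH]; first by rewrite mul0r; exact: words0.
rewrite mulrDl; apply: words_add => // {IH}.
elim: Wb => [|f' m' n' {}b _ IH]; first by rewrite mulr0; exact: words0.
rewrite mulrDr; apply: words_add => // {IH}.
have [g Hg] := monomial_iota m n f'.
have -> : iota f * u ^+ m * star u ^+ n * (iota f' * u ^+ m' * star u ^+ n') =
  iota (f * g) * u ^+ (m + m') * star u ^+ (n + n').
  rewrite (iota_mul hom) !exprD -!mulrA; congr (_ * _).
  have -> c : u ^+ m * (star u ^+ n * (iota f' * c)) = iota g * (u ^+ m * (star u ^+ n * c)).
    by rewrite !mulrA Hg !mulrA.
  congr (_ * (_ * _)); rewrite !mulrA; congr (_ * _).
  exact: (commrX _ (commr_sym (commrX _ cu))).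
exact: words_mono.
Qed.

Lemma words_star a : words a -> words (star a).
Proof.
have [su us] := cov_unitary cov.
have cu : GRing.comm u (star u) by rewrite /GRing.comm su us.
elim => [|f m n {}a _ IH]; first by rewrite star0; exact: words0.
rewrite starD; apply: words_add => //.
rewrite !starM !starX starK mulrA; case: (hom) => _ _ <-.
have [g ->] := monomial_iota n m (Cconj f).
by rewrite mulrA; exact: words_mono.
Qed.

Lemma words_dense : norm_closure words = setT.
Proof.
apply/seteqP; split => // a _; have : cstar_generated (range iota `|` [set u]) a by rewrite gen.
apply; split.
- apply: norm_closure_subalgebra; last first.
  + exact: words_star.
  + exact: words_mul.
  + exact: words_add.
  move=> c; have := words_mono (c *: (1 : Cfun R X)) 0%N 0%N.
  by rewrite (iota_scale hom) (iota_one hom) !expr0 !mulr1.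
- have sub b : words b -> norm_closure words b.
    by move=> Wb e e0; exists b => //; rewrite subrr cnorm0.
  move=> _ [[f _ <-]|->]; apply: sub.
    by have := words_mono f 0%N 0%N; rewrite !expr0 !mulr1.
  by have := words_mono 1 1%N 0%N; rewrite (iota_one hom) expr1 expr0 mulr1 mul1r.
Qed.

Lemma tr_iota t f : tracial_states t ->
  tr t (iota f) = tr t (J (fun x => complex.Re (Cval f x))).
Proof.
move=> Tt.
have cr : continuous (fun x => complex.Re (Cval f x)).
  by move=> x; apply: continuous_comp; [exact: Cval_cts|exact: Re_continuous].
have ci : continuous (fun x => complex.Im (Cval f x)).
  by move=> x; apply: continuous_comp; [exact: Cval_cts|exact: Im_continuous].
have -> : iota f = J (fun x => complex.Re (Cval f x)) + 'i *: J (fun x => complex.Im (Cval f x)).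
  rewrite /iotaR -(iota_scale hom) -(iota_add hom); congr iota; apply: Cfun_eqP => x.
  rewrite -[RHS]/(Cval (realC _) x + 'i * Cval (realC _) x) !realCE //.
  exact: complexE.
rewrite trD // {2}/tr tracialZ //.
have [_] := tracial_sa Tt (iotaR_star hom (fun x => complex.Im (Cval f x))).
by case: (t _) => p q /= ->; rewrite mul0r mulr0 subrr addr0.
Qed.

Lemma trace_determined s t : tracial_states s -> tracial_states t ->
  (forall h, continuous h -> tr s (J h) = tr t (J h)) -> forall a, tr s a = tr t a.
Proof.
move=> Ts Tt st a.
have sti f : tr s (iota f) = tr t (iota f).
  rewrite (tr_iota f Ts) (tr_iota f Tt); apply: st => x.
  by apply: continuous_comp; [exact: Cval_cts|exact: Re_continuous].
have stw w : words w -> tr s w = tr t w.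
  elim => [|f m n {}a' _ IH]; first by rewrite !tr0.
  by rewrite !trD // IH (trace_monomial Ts Tt).
apply/eqP; rewrite -subr_eq0 -normr_le0; apply/ler_addgt0Pr => e e0; rewrite add0r.
have e2 : 0 < e / 2 by rewrite divr_gt0.
have : norm_closure words a by rewrite words_dense.
move=> /(_ _ e2)[w Ww nw].
have -> : tr s a - tr t a = tr s (a - w) - tr t (a - w).
  by rewrite !trB // (stw w Ww); ring.
rewrite (le_trans (ler_normB _ _)) // [leRHS]splitr lerD //.
  by rewrite (le_trans (tr_norm_le Ts _)) // ltW.
by rewrite (le_trans (tr_norm_le Tt _)) // ltW.
Qed.

End Uniqueness.

(** * Affine functions on the trace space *)

Lemma cts_Csub (R : realType) (U : topologicalType) (p q : U -> R[i]^o) :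
  continuous p -> continuous q -> continuous (fun t => p t - q t : R[i]^o).
Proof. by move=> cp cq x; exact: (@cvgB _ (R[i]^o) _ _ _ p q _ _ (cp x) (cq x)). Qed.
Lemma cts_Cadd (R : realType) (U : topologicalType) (p q : U -> R[i]^o) :
  continuous p -> continuous q -> continuous (fun t => p t + q t : R[i]^o).
Proof. by move=> cp cq x; exact: (@cvgD _ (R[i]^o) _ _ _ p q _ _ (cp x) (cq x)). Qed.
Lemma cts_Cmul (R : realType) (U : topologicalType) c (q : U -> R[i]^o) :
  continuous q -> continuous (fun t => c * q t : R[i]^o).
Proof. by move=> cq x; apply: cvgM; [exact: cvg_cst|exact: cq]. Qed.
Lemma cts_Ccst (R : realType) (U : topologicalType) (c : R[i]^o) :
  continuous (fun _ : U => c).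
Proof. by move=> x; exact: cvg_cst. Qed.

Section TraceSpace.
Variables (R : realType) (A : cstarAlgType R).
Local Notation E := {ptws A -> R[i]^o}.
Local Notation T := (@tracial_states R A).
Implicit Types (s t : E) (a b : A).

Lemma eval_cts a : continuous (fun t : E => t a : R[i]^o).
Proof. exact: (@proj_continuous _ (fun _ : A => R[i]^o) a). Qed.

Lemma tr_cts a : continuous (fun t : E => tr t a).
Proof. by move=> t; apply: continuous_comp; [exact: eval_cts|exact: Re_continuous]. Qed.

Lemma closed_zero (U : topologicalType) (p : U -> R) : continuous p -> closed [set x | p x = 0].
Proof.
move=> cp; have -> : [set x | p x = 0] = p @^-1` [set 0] by [].
by apply: preimage_closed => //; exact: closed_eq.
Qed.

Lemma closed_nonneg (U : topologicalType) (p : U -> R) : continuous p -> closed [set x | 0 <= p x].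
Proof.
move=> cp; have -> : [set x | 0 <= p x] = p @^-1` [set y | 0 <= y] by [].
by apply: preimage_closed => //; exact: closed_ge.
Qed.

Lemma closed_Czero (p : E -> R[i]^o) : continuous p -> closed [set t | p t = 0].
Proof.
move=> cp.
have -> : [set t | p t = 0] =
    [set t | complex.Re (p t) = 0] `&` [set t | complex.Im (p t) = 0].
  by apply/seteqP; split => [t /= ->|t [/= re im]] //; case: (p t) re im => x y /= -> ->.
apply: closedI; apply: closed_zero => t; apply: continuous_comp; try exact: cp.
  exact: Re_continuous.
exact: Im_continuous.
Qed.

Lemma tracial_closed : closed T.
Proof.
have -> : T = (\bigcap_(x in [set: R[i] * A * A])
      [set t : E | t (x.1.1 *: x.1.2 + x.2) - (x.1.1 * t x.1.2 + t x.2) = 0 :> R[i]^o]) `&`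
    ((\bigcap_(a in [set: A]) ([set t : E | complex.Im (t (star a * a)) = 0] `&`
                            [set t : E | 0 <= complex.Re (t (star a * a))])) `&`
    ([set t : E | t 1 - 1 = 0 :> R[i]^o] `&`
    (\bigcap_(x in [set: A * A]) [set t : E | t (x.1 * x.2) - t (x.2 * x.1) = 0 :> R[i]^o]))).
  apply/seteqP; split => t.
    move=> [tl tp t1 tC]; split; [|split; [|split]].
    - by move=> [[c a] b] _ /=; rewrite tl subrr.
    - move=> a _; have := tp a; rewrite lecE => /andP[/eqP im re]; split => //.
    - by rewrite /= t1 subrr.
    - by move=> [a b] _ /=; rewrite tC subrr.
  move=> [tl [tp [t1 tC]]]; split.
  - by move=> c a b; apply/eqP; rewrite -subr_eq0; apply/eqP; exact: (tl (c, a, b) I).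
  - by move=> a; have [im re] := tp a I; rewrite lecE im eqxx.
  - by apply/eqP; rewrite -subr_eq0; apply/eqP.
  - by move=> a b; apply/eqP; rewrite -subr_eq0; apply/eqP; exact: (tC (a, b) I).
apply: closedI; [|apply: closedI; [|apply: closedI]].
- apply: closed_bigI => -[[c a] b] _; apply: closed_Czero; apply: cts_Csub; first exact: eval_cts.
  by apply: cts_Cadd; [apply: cts_Cmul; exact: eval_cts|exact: eval_cts].
- apply: closed_bigI => a _; apply: closedI.
    by apply: closed_zero => t; apply: continuous_comp; [exact: eval_cts|exact: Im_continuous].
  by apply: closed_nonneg => t; apply: continuous_comp; [exact: eval_cts|exact: Re_continuous].
- apply: closed_Czero; apply: (@cts_Csub _ _ (fun t : E => t 1 : R[i]^o) (fun=> 1)).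
    exact: (@eval_cts 1).
  exact: (@cts_Ccst R E 1).
- apply: closed_bigI => -[a b] _; apply: closed_Czero.
  apply: (@cts_Csub _ _ (fun t : E => t (a * b) : R[i]^o) (fun t : E => t (b * a) : R[i]^o)).
    exact: (@eval_cts (a * b)).
  exact: (@eval_cts (b * a)).
Qed.

(** The space of traces is a closed subset of a product of squares. *)
Lemma tracial_compact : compact T.
Proof.
pose D a : set R[i]^o := (fun z : R * R => (z.1 +i* z.2)%C : R[i]^o) @`
  (`[- cnorm a, cnorm a]%classic `*` `[- cnorm a, cnorm a]%classic).
apply: (@subclosed_compact _ _ [set t : E | forall a, D a (t a)]).
- exact: tracial_closed.
- apply: (@tychonoff A (fun=> R[i]^o) D) => a; apply: continuous_compact.
    by apply: continuous_subspaceT; exact: Complex_continuous.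
  by apply: compact_setX; exact: segment_compact.
move=> t Tt a; exists (complex.Re (t a), complex.Im (t a)); last by case: (t a).
have := tr_norm_le Tt a; have := tr_norm_le Tt ('i *: a).
rewrite cnormi /tr tracialZ //; case: (t a) => x y /=.
by rewrite mul0r mul1r sub0r normrN !ler_norml /= !in_itv /= => -> ->.
Qed.

Lemma tr_inj s t : T s -> T t -> (forall a, tr s a = tr t a) -> s = t.
Proof.
move=> Ts Tt st; apply/funext => a; apply/eqP; rewrite eq_complex; apply/andP; split.
  by apply/eqP; exact: st.
have := st ('i *: a); rewrite /tr !tracialZ //; case: (s a) => x y; case: (t a) => x' y' /=.
by rewrite !mul0r !mul1r !sub0r => /oppr_inj ->.
Qed.

Definition mix (l : R) s t : E := fun a => l%:C * s a + (1 - l)%:C * t a.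

Lemma tracial_mix l s t : T s -> T t -> 0 <= l <= 1 -> T (mix l s t).
Proof.
move=> [sl sp s1 sC] [tl tp t1 tC] /andP[l0 l1]; split.
- by move=> c a b; rewrite /mix sl tl -![_ *: _]/(_ * _); ring.
- by move=> a; rewrite addr_ge0 // mulr_ge0 // lecR // subr_ge0.
- by rewrite /mix s1 t1 !mulr1 -rmorphD /= addrC subrK.
- by move=> a b; rewrite /mix sC tC.
Qed.

Lemma tr_mix l s t a : tr (mix l s t) a = l * tr s a + (1 - l) * tr t a.
Proof. by rewrite /tr /mix; case: (s a) => x y; case: (t a) => x' y' /=; rewrite !mul0r !subr0. Qed.

(** First-order condition for a minimum at the left end of a segment. *)
Lemma quadratic_first_order (B C : R) : 0 <= C ->
  (forall l, 0 <= l <= 1 -> 0 <= 2 * l * B + l ^+ 2 * C) -> 0 <= B.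
Proof.
move=> C0 H; rewrite leNgt; apply/negP => B0.
have CB : 0 < C - B by lra.
have := H (- B / (C - B)) _; have -> : 0 <= - B / (C - B) <= 1.
  apply/andP; split; first by rewrite divr_ge0 //; lra.
  by rewrite ler_pdivrMr // mul1r; lra.
move=> /(_ isT).
have -> : 2 * (- B / (C - B)) * B + (- B / (C - B)) ^+ 2 * C =
    - (B ^+ 2 / (C - B) ^+ 2) * (C - 2 * B).
  by field; rewrite gt_eqF.
rewrite leNgt mulNr oppr_lt0 mulr_gt0 //; last by lra.
apply: divr_gt0; last exact: exprn_gt0.
by rewrite exprn_even_gt0 //= lt_eqF.
Qed.

(** The pairs (t, h t + e) and (s, h s) are never equal.  By compactness finitely many
    evaluations phi i, together with the values of h, already distinguish them,
    so the squared distance q between the two graphs, measured in these coordinates,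
    has a positive minimum q0.  At a minimum, convexity of the graphs
    gives a linear functional that separates them by q0.  Its slope d in the
    direction of h is negative, as the case s = t shows, and dividing by -d shows
    that h differs from the combination of the phi i by a function of oscillation
    at most e. *)
Lemma affine_approx (I : choiceType) (i0 : I) (phi : I -> A) :
  (forall s t, T s -> T t -> (forall i, tr s (phi i) = tr t (phi i)) -> s = t) ->
  forall h, @Aff_T R A h -> forall e : R, 0 < e -> T !=set0 ->
  exists (D : seq I) (c : I -> R) (c0 : R), forall t, T t ->
    `|\sum_(i <- D) c i * tr t (phi i) + c0 - h t| <= e.
Proof.
move=> sep h [ch haff] e e0 [t1 Tt1].
pose Q : set (E * R) := (fun t => (t, h t)) @` T.
have cQ : compact Q.
  apply: continuous_compact; last exact: tracial_compact.
  have cid : {within T, continuous (fun t : E => t)}.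
    by apply: continuous_subspaceT => x; exact: cvg_id.
  exact: (pair_cts cid ch).
pose G := Q `*` Q.
have cG : compact G by exact: compact_setX.
have c11 a : continuous (fun z : (E * R) * (E * R) => tr z.1.1 a).
  move=> z; apply: (@continuous_comp _ _ _ (fun z : (E * R) * (E * R) => z.1.1)
    (fun t => tr t a)); last exact: tr_cts.
  by apply: continuous_comp; exact: cvg_fst.
have c21 a : continuous (fun z : (E * R) * (E * R) => tr z.2.1 a).
  move=> z; apply: (@continuous_comp _ _ _ (fun z : (E * R) * (E * R) => z.2.1)
    (fun t => tr t a)); last exact: tr_cts.
  by apply: continuous_comp; [exact: cvg_snd|exact: cvg_fst].
have cd : continuous (fun z : (E * R) * (E * R) => z.1.2 - z.2.2 - e).
  apply: cts_sub; last exact: cts_cst.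
  by apply: cts_sub => z; apply: continuous_comp; do ?[exact: cvg_fst|exact: cvg_snd].
have cp i : continuous (fun z : (E * R) * (E * R) => tr z.1.1 (phi i) - tr z.2.1 (phi i)).
  exact: cts_sub.
pose V i : set ((E * R) * (E * R)) :=
  ~` ([set z | tr z.1.1 (phi i) - tr z.2.1 (phi i) = 0] `&`
      [set z | z.1.2 - z.2.2 - e = 0]).
have [||D HD] := compact_seq_cover (V := V) cG.
- by move=> i; apply: closed_openC; apply: closedI; exact: closed_zero.
- move=> [[? ?] [? ?]] [/= [s Ts [<- <-]] [t Tt [<- <-]]].
  apply: contrapT => nV.
  have H i : tr s (phi i) - tr t (phi i) = 0 /\ h s - h t - e = 0.
    by apply: contrapT => n; apply: nV; exists i.
  have st : s = t by apply: sep => // i; apply/eqP; rewrite -subr_eq0; apply/eqP; case: (H i).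
  by have [_] := H i0; rewrite st; lra.
pose q (z : (E * R) * (E * R)) :=
  \sum_(i <- D) (tr z.1.1 (phi i) - tr z.2.1 (phi i)) ^+ 2 +
  (z.1.2 - z.2.2 - e) ^+ 2.
have cq : continuous q.
  apply: cts_add; last exact: cts_sqr.
  by apply: cts_sum => i; apply: cts_sqr; exact: cp.
have [||z0 Gz0 qmin] := @compact_EVT_min _ R q G _ cG.
- by exists ((t1, h t1), (t1, h t1)); split; exists t1.
- exact: continuous_subspaceT.
have {}qmin z : G z -> q z0 <= q z by move=> Gz; apply: qmin; rewrite mem_set.
have {}Gz0 : G z0 by rewrite inE in Gz0.
have q0 : 0 < q z0.
  have [i iD Vi] := HD z0 Gz0; rewrite lt_neqAle eq_sym; apply/andP; split; last first.
    by rewrite addr_ge0 ?sqr_ge0 // sumr_ge0 // => j _; rewrite sqr_ge0.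
  apply/negP; rewrite paddr_eq0 ?sqr_ge0 //; last by rewrite sumr_ge0 // => j _; rewrite sqr_ge0.
  rewrite sqrf_eq0 psumr_eq0 => [|j _]; last exact: sqr_ge0.
  move=> /andP[/allP qi /eqP qd]; apply: Vi; split => //=.
  by apply/eqP; rewrite -sqrf_eq0; exact: qi.
case: z0 Gz0 q0 qmin => [[? ?] [? ?]] [/= [s0 Ts0 [<- <-]] [t0 Tt0 [<- <-]]] q0 qmin.
pose y s t i := tr s (phi i) - tr t (phi i); pose d s t := h s - h t - e.
have key s t : T s -> T t ->
    0 < \sum_(i <- D) y s0 t0 i * y s t i + d s0 t0 * d s t.
  move=> Ts Tt.
  pose B := \sum_(i <- D) y s0 t0 i * (y s t i - y s0 t0 i) + d s0 t0 * (d s t - d s0 t0).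
  pose C := \sum_(i <- D) (y s t i - y s0 t0 i) ^+ 2 + (d s t - d s0 t0) ^+ 2.
  have qE : q (s0, h s0, (t0, h t0)) = \sum_(i <- D) y s0 t0 i ^+ 2 + d s0 t0 ^+ 2 by [].
  have : 0 <= B.
    apply: (@quadratic_first_order B C).
      by rewrite addr_ge0 ?sqr_ge0 // sumr_ge0 // => i _; rewrite sqr_ge0.
    move=> l l01; have Ts' := tracial_mix Ts Ts0 l01; have Tt' := tracial_mix Tt Tt0 l01.
    have := qmin ((mix l s s0, h (mix l s s0)), (mix l t t0, h (mix l t t0))).
    have -> : q ((mix l s s0, h (mix l s s0)), (mix l t t0, h (mix l t t0))) =
        q (s0, h s0, (t0, h t0)) + (2 * l * B + l ^+ 2 * C).
      rewrite qE /q /= (haff _ _ _ Ts Ts0 l01) (haff _ _ _ Tt Tt0 l01).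
      have -> : \sum_(i <- D) (tr (mix l s s0) (phi i) - tr (mix l t t0) (phi i)) ^+ 2 =
          \sum_(i <- D) y s0 t0 i ^+ 2 + 2 * l * \sum_(i <- D) y s0 t0 i * (y s t i - y s0 t0 i) +
          l ^+ 2 * \sum_(i <- D) (y s t i - y s0 t0 i) ^+ 2.
        rewrite !mulr_sumr -!big_split /=; apply: eq_bigr => i _.
        by rewrite !tr_mix /y; ring.
      by rewrite /B /C /d; ring.
    rewrite lerDl; apply; split => /=; last by exists (mix l t t0).
    by exists (mix l s s0).
  have -> : \sum_(i <- D) y s0 t0 i * y s t i + d s0 t0 * d s t = q (s0, h s0, (t0, h t0)) + B.
    have -> : \sum_(i <- D) y s0 t0 i * y s t i =
        \sum_(i <- D) y s0 t0 i ^+ 2 + \sum_(i <- D) y s0 t0 i * (y s t i - y s0 t0 i).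
      by rewrite -big_split /=; apply: eq_bigr => i _; ring.
    by rewrite qE /B; ring.
  by move=> B0; rewrite ltr_wpDr.
(* the functional takes the value - e * d s0 t0 on the diagonal *)
have d0 : d s0 t0 < 0.
  have := key t1 t1 Tt1 Tt1; rewrite big1 ?add0r; last by move=> i _; rewrite /y subrr mulr0.
  by rewrite /d !subrr !sub0r; nra.
pose c i := y s0 t0 i / - d s0 t0.
pose L t := \sum_(i <- D) c i * tr t (phi i).
have osc s t : T s -> T t -> L t - h t <= L s - h s + e.
  move=> Ts Tt; have := key s t Ts Tt.
  have -> : \sum_(i <- D) y s0 t0 i * y s t i = - d s0 t0 * (L s - L t).
    rewrite /L -sumrB mulr_sumr; apply: eq_bigr => i _.
    by rewrite /c /y; field; rewrite lt_eqF.
  rewrite mulNr addrC -mulrBr => dpos.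
  have : d s t - (L s - L t) < 0.
    by rewrite ltNge; apply/negP => H; move: dpos; rewrite ltNge (mulr_le0_ge0 (ltW d0) H).
  by rewrite /d; lra.
exists D, c, (h t1 - L t1) => t Tt; rewrite -/(L t) ler_norml.
by have := osc t t1 Tt Tt1; have := osc t1 t Tt1 Tt; lra.
Qed.
End TraceSpace.

(** * Rigidity *)

Lemma real_rank_le0 (R : realType) (A : cstarAlgType R) (S : set A) :
  real_rank S = 0%E -> real_rank_le S 0.
Proof.
move=> rr; have : (ereal_inf [set n%:R%:E | n in [set n | real_rank_le S n]] < (1 : R)%:E)%E.
  by rewrite -/(real_rank S) rr lte_fin ltr01.
by move=> /ereal_inf_lt[_ [[|n] Sn <-]] //; rewrite lte_fin ltrn1.
Qed.

(** Two projections, for f and its positive part: f is the difference of the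
    positive functions max(0, f) and max(0, f) - f. *)
Lemma signed_approx (R : realType) (Omega : topologicalType) (w0 : Omega)
  (Omega_connected : connected [set: Omega])
  (alpha : homeomorphism (cantor_space * Omega)%type) (alpha_minimal : minimal alpha)
  (A : cstarAlgType R) (iota : Cfun R (cantor_space * Omega)%type -> A) (u : A)
  (cov : covariant alpha iota u) (S : set A) (f : cantor_space * Omega -> R) (e : R) :
  real_rank_le S 0 -> range iota `<=` S -> continuous f -> 0 < e ->
  exists g : K0 A, forall t, tracial_states t -> `|rho g t - tr t (iotaR iota f)| <= e.
Proof.
move=> RR0 iS cf e0; have e2 : 0 < e / 2 by rewrite divr_gt0.
pose fp x := Num.max 0 (f x); pose fm x := fp x - f x.
have cfp : continuous fp.
  by move=> x; apply: (@continuous_max R _ (fun=> 0) f); [exact: cvg_cst|exact: cf].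
have cfm : continuous fm by exact: cts_sub.
have fp0 x : 0 <= fp x by rewrite /fp le_max lexx.
have fm0 x : 0 <= fm x by rewrite /fm subr_ge0 /fp le_max lexx orbT.
have [P HP] := positive_approx w0 Omega_connected alpha_minimal cov RR0 iS cfp fp0 e2.
have [Q HQ] := positive_approx w0 Omega_connected alpha_minimal cov RR0 iS cfm fm0 e2.
exists (K0_class P - K0_class Q) => t Tt; rewrite rhoE //.
have -> : iotaR iota f = iotaR iota fp - iotaR iota fm.
  rewrite -(iotaR_sub (cov_hom cov)) //; congr (iotaR iota _).
  by apply/funext => x; rewrite /fm opprB addrC subrK.
rewrite trB //; have := HP t Tt; have := HQ t Tt; rewrite !ler_norml.
by move=> /andP[? ?] /andP[? ?]; apply/andP; split; lra.
Qed.

Theorem theorem3p7 (R : realType) (Omega : topologicalType)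
  (Omega_CW : finite_CW_complex R Omega)
  (Omega_connected : connected [set: Omega])
  (alpha : homeomorphism (cantor_space * Omega)%type)
  (alpha_minimal : minimal alpha)
  (A : cstarAlgType R) (iota : Cfun R (cantor_space * Omega)%type -> A) (u : A)
  (A_crossed_product : crossed_product alpha iota u)
  (RR0 : exists x : cantor_space, real_rank (orbit_breaking iota u x) = 0%E) :
  rho_dense A.
Proof.
have [cov gen _] := A_crossed_product; have hom := cov_hom cov.
case: RR0 => x0 /real_rank_le0 RR0 h hA e e0.
have iS : range iota `<=` orbit_breaking iota u x0.
  by move=> a ia B [_ GB]; apply: GB; left.
have [[w0]|noW] := pselect (inhabited Omega); last first.
  have : (1 : A) = 0.
    rewrite -(iota_one hom) -(iota_zero hom); congr iota.
    by apply: Cfun_eqP => -[k w]; case: noW; exists.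
  by move/eqP; rewrite oner_eq0.
have [T0|noT] := pselect (@tracial_states R A !=set0); last first.
  by exists 0 => t Tt; case: noT; exists t.
have sep s t : tracial_states s -> tracial_states t ->
    (forall f, tr s (iota f) = tr t (iota f)) -> s = t.
  move=> Ts Tt st; apply: tr_inj => //.
  by apply: (trace_determined w0 Omega_connected alpha_minimal cov gen) => // f _; exact: st.
have e4 : 0 < e / 4 by rewrite divr_gt0.
have [D [c [c0 Hc]]] := affine_approx (0 : Cfun R _) sep hA e4 T0.
have cre (f : Cfun R (cantor_space * Omega)%type) : continuous (fun x => complex.Re (Cval f x)).
  by move=> x; apply: continuous_comp; [exact: Cval_cts|exact: Re_continuous].
pose f x := \sum_(i <- D) c i * complex.Re (Cval i x) + c0 * 1.
have cs : continuous (fun x => \sum_(i <- D) c i * complex.Re (Cval i x)).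
  by apply: cts_sum => i; exact: cts_scale.
have c1 : continuous (fun _ : cantor_space * Omega => c0 * 1) by exact: cts_cst.
have cf : continuous f by exact: cts_add.
have [g Hg] := signed_approx w0 Omega_connected alpha_minimal cov RR0 iS cf e4.
exists g => t Tt; have := Hg t Tt; have := Hc t Tt.
have -> : tr t (iotaR iota f) = \sum_(i <- D) c i * tr t (iota i) + c0.
  rewrite (iotaR_add hom) // (iotaR_scale hom); last exact: cts_cst.
  rewrite (iotaR1 hom) trD // trZ // tr1 // mulr1 (iotaR_sum hom); last first.
    by move=> i; exact: cts_scale.
  rewrite tr_sum //; congr (_ + _); apply: eq_bigr => i _.
  by rewrite (iotaR_scale hom) // trZ // (tr_iota cov).
rewrite !ler_norml ltr_norml => /andP[? ?] /andP[? ?]; apply/andP; split; lra.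
Qed.
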